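(* Let $\lambda,\mu\in\mathbb{H}$ and let $$g^{\mu,\lambda}(x):=\sum_{n=1}^{+\infty}\frac{x^n}{n!}\sum_{k=0}^{n-1}\mu^k\lambda^{n-k-1}.$$ The series converges uniformly on the compact sets of $\mathbb{H}$ to an entire slice-regular function such that $\mathcal{D}_\lambda(g^{\mu,\lambda})=\exp_\mu(x)$ and $g^{\mu,\lambda}(0)=0$. As a consequence, for every axially symmetric domain $\Omega$ and every slice-constant function $h$ on $\Omega$, $\mathcal{D}_\lambda(h\cdot g^{\mu,\lambda})=h\cdot\exp_\mu(x)$ on $\Omega$. If $\lambda$ and $\mu$ commute and $\lambda\neq\mu$, then $g^{\mu,\lambda}(x)=(\exp_\mu(x)-\exp_\lambda(x))(\mu-\lambda)^{-1}$. If $\lambda=\mu$, then $g^{\lambda,\lambda}(x)=x\exp_\lambda(x)$.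
   Context: $\mathbb{H}$ is the skew field of quaternions, $\mathbb{S}=\{J\in\mathbb{H}: J^2=-1\}$; the convention $\lambda^0=1$ is used for every $\lambda\in\mathbb{H}$. For an open set $D\subseteq\mathbb{C}$ invariant under complex conjugation, put $\Omega_D=\{\alpha+J\beta:\ \alpha+i\beta\in D,\ J\in\mathbb{S}\}\subseteq\mathbb{H}$. An axially symmetric domain is a connected open set $\Omega=\Omega_D$ of this form. A stem function on $D$ is a map $F=F_1+\imath F_2:D\to\mathbb{H}\otimes_{\mathbb{R}}\mathbb{C}$ ($F_1,F_2$ $\mathbb{H}$-valued, $\imath$ the central imaginary unit of the factor $\mathbb{C}$) with $F(\overline z)=\overline{F(z)}$, conjugation acting on the factor $\mathbb{C}$. It induces the slice function $f=\mathcal{I}(F):\Omega_D\to\mathbb{H}$, $f(\alpha+J\beta)=F_1(\alpha+i\beta)+JF_2(\alpha+i\beta)$. For $F$ of class $C^1$, the slice derivative is $\frac{\partial f}{\partial x}=\mathcal{I}(\frac{\partial F}{\partial z})$ with $\frac{\partial}{\partial z}=\frac12(\partial_\alpha-\imath\partial_\beta)$. $f$ is slice-regular if $F$ is holomorphic, i.e. $\frac12(\partial_\alpha+\imath\partial_\beta)F=0$; it is entire if moreover $\Omega=\mathbb{H}$. A slice-constant function is a slice-regular $g$ with $\frac{\partial g}{\partial x}=0$. The slice product of $f=\mathcal{I}(F)$, $g=\mathcal{I}(G)$ is $f\cdot g=\mathcal{I}(FG)$, with $FG$ the pointwise product in $\mathbb{H}\otimes\mathbb{C}$. For $\lambda\in\mathbb{H}$,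 $\exp_\lambda(x)=\sum_{n=0}^{+\infty}\frac{x^n\lambda^n}{n!}$, and $\mathcal{D}_\lambda f=\frac{\partial f}{\partial x}-f\lambda$ (pointwise right multiplication by $\lambda$). *)

(* Defs.v *)
From HB Require Import structures.
From mathcomp Require Import all_boot all_order all_algebra.
From mathcomp Require Import all_classical all_reals all_analysis.
From mathcomp Require Import ring lra.
Set Implicit Arguments.
Unset Strict Implicit.
Unset Printing Implicit Defensive.
Import Order.TTheory GRing.Theory Num.Theory.
Import numFieldNormedType.Exports.

Local Open Scope classical_set_scope.
Local Open Scope ring_scope.

(* Quaternions are row vectors (real part, i, j, k).  The norm inherited from
   'rV[R]_4 is the sup norm; it is not multiplicative, but it induces the usual
   topology and uniformity of R^4, and only these are used below. *)
Definition quat (R : realType) : Type := 'rV[R]_4.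

HB.instance Definition _ (R : realType) := NormedModule.copy (quat R) 'rV[R]_4.
HB.instance Definition _ (R : realType) := Complete.copy (quat R) 'rV[R]_4.

Section Quaternions.
Variable R : realType.
Implicit Types (x y z : quat R).

Definition mkquat (a b c d : R) : quat R := \row_(i < 4) [:: a; b; c; d]`_i.

Definition qre x : R := x 0 (@Ordinal 4 0 isT).
Definition qi x : R := x 0 (@Ordinal 4 1 isT).
Definition qj x : R := x 0 (@Ordinal 4 2 isT).
Definition qk x : R := x 0 (@Ordinal 4 3 isT).

Lemma qre_mk a b c d : qre (mkquat a b c d) = a. Proof. by rewrite /qre mxE. Qed.
Lemma qi_mk a b c d : qi (mkquat a b c d) = b. Proof. by rewrite /qi mxE. Qed.
Lemma qj_mk a b c d : qj (mkquat a b c d) = c. Proof. by rewrite /qj mxE. Qed.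
Lemma qk_mk a b c d : qk (mkquat a b c d) = d. Proof. by rewrite /qk mxE. Qed.
Lemma qreD x y : qre (x + y) = qre x + qre y. Proof. by rewrite /qre mxE. Qed.
Lemma qiD x y : qi (x + y) = qi x + qi y. Proof. by rewrite /qi mxE. Qed.
Lemma qjD x y : qj (x + y) = qj x + qj y. Proof. by rewrite /qj mxE. Qed.
Lemma qkD x y : qk (x + y) = qk x + qk y. Proof. by rewrite /qk mxE. Qed.
Lemma qreN x : qre (- x) = - qre x. Proof. by rewrite /qre mxE. Qed.
Lemma qiN x : qi (- x) = - qi x. Proof. by rewrite /qi mxE. Qed.
Lemma qjN x : qj (- x) = - qj x. Proof. by rewrite /qj mxE. Qed.
Lemma qkN x : qk (- x) = - qk x. Proof. by rewrite /qk mxE. Qed.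
Lemma qreZ a x : qre (a *: x) = a * qre x. Proof. by rewrite /qre mxE. Qed.
Lemma qiZ a x : qi (a *: x) = a * qi x. Proof. by rewrite /qi mxE. Qed.
Lemma qjZ a x : qj (a *: x) = a * qj x. Proof. by rewrite /qj mxE. Qed.
Lemma qkZ a x : qk (a *: x) = a * qk x. Proof. by rewrite /qk mxE. Qed.
Lemma qre0 : qre 0 = 0. Proof. by rewrite /qre mxE. Qed.
Lemma qi0 : qi 0 = 0. Proof. by rewrite /qi mxE. Qed.
Lemma qj0 : qj 0 = 0. Proof. by rewrite /qj mxE. Qed.
Lemma qk0 : qk 0 = 0. Proof. by rewrite /qk mxE. Qed.

Lemma quatP x y :
  qre x = qre y -> qi x = qi y -> qj x = qj y -> qk x = qk y -> x = y.
Proof.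
move=> h0 h1 h2 h3; apply/rowP => -[[|[|[|[|//]]]] hi].
- by rewrite (_ : Ordinal hi = @Ordinal 4 0 isT) //; apply: val_inj.
- by rewrite (_ : Ordinal hi = @Ordinal 4 1 isT) //; apply: val_inj.
- by rewrite (_ : Ordinal hi = @Ordinal 4 2 isT) //; apply: val_inj.
- by rewrite (_ : Ordinal hi = @Ordinal 4 3 isT) //; apply: val_inj.
Qed.

Definition qone : quat R := mkquat 1 0 0 0.

Definition qmul x y : quat R := mkquat
  (qre x * qre y - qi x * qi y - qj x * qj y - qk x * qk y)
  (qre x * qi y + qi x * qre y + qj x * qk y - qk x * qj y)
  (qre x * qj y - qi x * qk y + qj x * qre y + qk x * qi y)
  (qre x * qk y + qi x * qj y - qj x * qi y + qk x * qre y).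

Definition qcoordE := (qre_mk, qi_mk, qj_mk, qk_mk, qreD, qiD, qjD, qkD,
  qreN, qiN, qjN, qkN, qreZ, qiZ, qjZ, qkZ, qre0, qi0, qj0, qk0).

Lemma qmulA : associative qmul.
Proof. by move=> x y z; apply: quatP; rewrite !qcoordE; ring. Qed.
Lemma qmul1x : left_id qone qmul.
Proof. by move=> x; apply: quatP; rewrite !qcoordE; ring. Qed.
Lemma qmulx1 : right_id qone qmul.
Proof. by move=> x; apply: quatP; rewrite !qcoordE; ring. Qed.
Lemma qmulDl : left_distributive qmul +%R.
Proof. by move=> x y z; apply: quatP; rewrite !qcoordE; ring. Qed.
Lemma qmulDr : right_distributive qmul +%R.
Proof. by move=> x y z; apply: quatP; rewrite !qcoordE; ring. Qed.
Lemma qone_neq0 : qone != 0.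
Proof.
by apply/eqP => /(congr1 qre); rewrite !qcoordE; apply/eqP; rewrite oner_eq0.
Qed.
End Quaternions.

HB.instance Definition _ (R : realType) := GRing.Zmodule_isNzRing.Build (quat R)
  (@qmulA R) (@qmul1x R) (@qmulx1 R) (@qmulDl R) (@qmulDr R) (@qone_neq0 R).

Section QuaternionAlgebra.
Variable R : realType.
Implicit Types (x y z : quat R).

Lemma qre1 : qre (1 : quat R) = 1. Proof. exact: qre_mk. Qed.
Lemma qi1 : qi (1 : quat R) = 0. Proof. exact: qi_mk. Qed.
Lemma qj1 : qj (1 : quat R) = 0. Proof. exact: qj_mk. Qed.
Lemma qk1 : qk (1 : quat R) = 0. Proof. exact: qk_mk. Qed.
Lemma qreM x y :
  qre (x * y) = qre x * qre y - qi x * qi y - qj x * qj y - qk x * qk y.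
Proof. exact: qre_mk. Qed.
Lemma qiM x y :
  qi (x * y) = qre x * qi y + qi x * qre y + qj x * qk y - qk x * qj y.
Proof. exact: qi_mk. Qed.
Lemma qjM x y :
  qj (x * y) = qre x * qj y - qi x * qk y + qj x * qre y + qk x * qi y.
Proof. exact: qj_mk. Qed.
Lemma qkM x y :
  qk (x * y) = qre x * qk y + qi x * qj y - qj x * qi y + qk x * qre y.
Proof. exact: qk_mk. Qed.

Definition qE := (@qcoordE R, qre1, qi1, qj1, qk1, qreM, qiM, qjM, qkM).

Lemma qscaleAl (a : R) x y : a *: (x * y) = (a *: x) * y.
Proof. by apply: quatP; rewrite !qE; ring. Qed.
Lemma qscaleAr (a : R) x y : a *: (x * y) = x * (a *: y).
Proof. by apply: quatP; rewrite !qE; ring. Qed.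
End QuaternionAlgebra.

HB.instance Definition _ (R : realType) :=
  GRing.Lmodule_isLalgebra.Build R (quat R) (@qscaleAl R).
HB.instance Definition _ (R : realType) :=
  GRing.Lalgebra_isAlgebra.Build R (quat R) (@qscaleAr R).

Section QuaternionInverse.
Variable R : realType.
Implicit Types (x y z : quat R).

Definition qconj x : quat R := mkquat (qre x) (- qi x) (- qj x) (- qk x).
Definition qnorm2 x : R := qre x ^+ 2 + qi x ^+ 2 + qj x ^+ 2 + qk x ^+ 2.
Definition qinv x : quat R := (qnorm2 x)^-1 *: qconj x.

Lemma qnorm2_eq0 x : (qnorm2 x == 0) = (x == 0).
Proof.
apply/eqP/eqP => [|->]; last by rewrite /qnorm2 !qE; ring.
rewrite /qnorm2 => h.
have := sqr_ge0 (qre x); have := sqr_ge0 (qi x).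
have := sqr_ge0 (qj x); have := sqr_ge0 (qk x) => h3 h2 h1 h0.
by apply: quatP; rewrite !qE; apply/eqP; rewrite -sqrf_eq0; apply/eqP; lra.
Qed.

Lemma qmulVx : {in [pred x | x != 0], left_inverse 1 qinv *%R}.
Proof.
move=> x; rewrite inE -qnorm2_eq0 => nx0.
by apply: quatP; rewrite /qinv /qconj !qE; move: nx0; rewrite /qnorm2 => nx0; field.
Qed.

Lemma qmulxV : {in [pred x | x != 0], right_inverse 1 qinv *%R}.
Proof.
move=> x; rewrite inE -qnorm2_eq0 => nx0.
by apply: quatP; rewrite /qinv /qconj !qE; move: nx0; rewrite /qnorm2 => nx0; field.
Qed.

Lemma qunitP x y : y * x = 1 /\ x * y = 1 -> [pred x | x != 0] x.
Proof.
move=> [yx _]; apply/eqP => x0; move: yx; rewrite x0 mulr0 => /eqP.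
by rewrite eq_sym oner_eq0.
Qed.

Lemma qinv_out : {in [predC [pred x | x != 0]], qinv =1 id}.
Proof.
move=> x; rewrite !inE negbK => /eqP ->.
by apply: quatP; rewrite /qinv /qconj !qE; ring.
Qed.
End QuaternionInverse.

HB.instance Definition _ (R : realType) := GRing.NzRing_hasMulInverse.Build
  (quat R) (@qmulVx R) (@qmulxV R) (@qunitP R) (@qinv_out R).

(* The algebra H (x) C: the pair (p, q) stands for p + I q, where I is the
   central imaginary unit.  The product is therefore not the componentwise
   product of pairs. *)
Definition quatC (R : realType) : Type := (quat R * quat R)%type.

HB.instance Definition _ (R : realType) :=
  NormedModule.copy (quatC R) (quat R * quat R)%type.

Section ComplexifiedQuaternions.
Variable R : realType.
Implicit Types (w t : quatC R).

Definition qCone : quatC R := (1, 0).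
Definition qCmul w t : quatC R :=
  (w.1 * t.1 - w.2 * t.2, w.1 * t.2 + w.2 * t.1).

Lemma qCmulA : associative qCmul.
Proof.
move=> [a b] [c d] [e f]; rewrite /qCmul /=; congr (_, _); apply: quatP;
  by rewrite !qE; ring.
Qed.
Lemma qCmul1x : left_id qCone qCmul.
Proof. by move=> [a b]; rewrite /qCmul /= !mul1r !mul0r subr0 addr0. Qed.
Lemma qCmulx1 : right_id qCone qCmul.
Proof. by move=> [a b]; rewrite /qCmul /= !mulr1 !mulr0 subr0 add0r. Qed.
Lemma qCmulDl : left_distributive qCmul +%R.
Proof.
move=> [a b] [c d] [e f]; congr (_, _); apply: quatP;
  by rewrite /= !qE; ring.
Qed.
Lemma qCmulDr : right_distributive qCmul +%R.
Proof.
move=> [a b] [c d] [e f]; congr (_, _); apply: quatP;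
  by rewrite /= !qE; ring.
Qed.
Lemma qCone_neq0 : qCone != 0.
Proof. by apply/eqP => -[] /eqP; rewrite oner_eq0. Qed.
End ComplexifiedQuaternions.

HB.instance Definition _ (R : realType) := GRing.Zmodule_isNzRing.Build (quatC R)
  (@qCmulA R) (@qCmul1x R) (@qCmulx1 R) (@qCmulDl R) (@qCmulDr R) (@qCone_neq0 R).

Definition qCI (R : realType) : quatC R := (0, 1).
Definition qCconj (R : realType) (w : quatC R) : quatC R := (w.1, - w.2).

(* The complex plane is R * R, with (a, b) standing for a + i b. *)
Section SliceFunctions.
Variable R : realType.
Implicit Types (D : set (R * R)) (F G : R * R -> quatC R) (f g h : quat R -> quat R).
Implicit Types (x lambda mu : quat R).

Definition imag_units : set (quat R) := [set J | J * J = -1].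

Definition conj_invariant D := forall a b, D (a, b) -> D (a, - b).

Definition circularization D : set (quat R) :=
  [set x | exists a b J, [/\ D (a, b), imag_units J & x = a%:A + b *: J]].

(* Omega_D is an axially symmetric domain *)
Definition axially_symmetric_domain D :=
  [/\ open D, conj_invariant D, open (circularization D)
    & connected (circularization D)].

Definition stem D F := forall a b, D (a, b) -> F (a, - b) = qCconj (F (a, b)).

(* The slice function I(F).  Every x is written as a + J b with b >= 0; J is
   arbitrary when x is real.  See slice_funE below for its values on a + J b
   for arbitrary J and b. *)
Definition qimnorm x : R := Num.sqrt (qi x ^+ 2 + qj x ^+ 2 + qk x ^+ 2).
Definition imag_dir x : quat R :=
  if qimnorm x == 0 then mkquat 0 1 0 0
  else (qimnorm x)^-1 *: mkquat 0 (qi x) (qj x) (qk x).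
Definition slice_fun F x : quat R :=
  let w := F (qre x, qimnorm x) in w.1 + imag_dir x * w.2.

Definition d_alpha F z : quatC R := 'D_((1, 0) : R * R) F z.
Definition d_beta F z : quatC R := 'D_((0, 1) : R * R) F z.
Definition d_z F z : quatC R := 2^-1 *: (d_alpha F z - qCI R * d_beta F z).
Definition d_zbar F z : quatC R := 2^-1 *: (d_alpha F z + qCI R * d_beta F z).

Definition class_C1 D F := forall z, D z ->
  [/\ derivable F z (1, 0), derivable F z (0, 1),
      {for z, continuous (d_alpha F)} & {for z, continuous (d_beta F)}].

Definition induces D F f :=
  stem D F /\ forall x, circularization D x -> f x = slice_fun F x.

Definition slice_regular D f := exists F,
  [/\ induces D F f, class_C1 D F & forall z, D z -> d_zbar F z = 0].

Definition entire f := slice_regular setT f.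

(* The stem function of a slice function on Omega_D; by induces_stem_of and
   induces_uniq it is the unique one, up to its values outside D. *)
Definition stem_of D f : R * R -> quatC R := xget (fun=> 0) [set F | induces D F f].

Definition slice_derivative D f : quat R -> quat R := slice_fun (d_z (stem_of D f)).

Definition slice_constant D f :=
  slice_regular D f /\ forall x, circularization D x -> slice_derivative D f x = 0.

Definition slice_prod D f g : quat R -> quat R :=
  slice_fun (fun z => stem_of D f z * stem_of D g z).

Definition slice_diff D lambda f x : quat R :=
  slice_derivative D f x - f x * lambda.

Definition qexp lambda x : quat R :=
  lim (series (fun n => n`!%:R^-1 *: (x ^+ n * lambda ^+ n)) @ \oo).

Definition gpartial mu lambda (N : nat) x : quat R :=
  \sum_(1 <= n < N.+1) (n`!%:R^-1 *: x ^+ n) *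
     \sum_(0 <= k < n) mu ^+ k * lambda ^+ (n - k - 1)%N.

Definition gfun mu lambda x : quat R := lim (gpartial mu lambda N x @[N --> \oo]).

Lemma imag_unitE (J : quat R) : imag_units J ->
  qre J = 0 /\ qi J ^+ 2 + qj J ^+ 2 + qk J ^+ 2 = 1.
Proof.
rewrite /imag_units /= => JJ.
have := congr1 (@qre R) JJ; have := congr1 (@qi R) JJ.
have := congr1 (@qj R) JJ; have := congr1 (@qk R) JJ.
rewrite !qE => hk hj hi h0.
have re0 : qre J = 0.
  have [//|re_neq0] := eqVneq (qre J) 0.
  have i0 : qi J = 0 by apply: (mulfI re_neq0); lra.
  have j0 : qj J = 0 by apply: (mulfI re_neq0); lra.
  have k0 : qk J = 0 by apply: (mulfI re_neq0); lra.
  by have := sqr_ge0 (qre J); rewrite expr2; move: h0; rewrite i0 j0 k0; lra.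
by split=> //; move: h0; rewrite re0 !expr2; lra.
Qed.

Lemma slice_funE D F (a b : R) (J : quat R) :
  stem D F -> D (a, b) -> imag_units J ->
  slice_fun F (a%:A + b *: J) = (F (a, b)).1 + J * (F (a, b)).2.
Proof.
move=> sF Dab /imag_unitE [J0 J1].
have re_x : qre (a%:A + b *: J) = a by rewrite !qE J0; ring.
have im_x : qimnorm (a%:A + b *: J) = `|b|.
  rewrite /qimnorm !qE -sqrtr_sqr; congr Num.sqrt.
  by rewrite -[RHS]mulr1 -J1; ring.
rewrite /slice_fun /imag_dir re_x im_x normr_eq0.
have vec_x : mkquat 0 (qi (a%:A + b *: J)) (qj (a%:A + b *: J))
    (qk (a%:A + b *: J)) = b *: J.
  by apply: quatP; rewrite !qE ?J0; ring.
have [b0|b_neq0] := eqVneq b 0.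
  have := sF _ _ Dab; rewrite b0 normr0 oppr0; case: (F (a, 0)) => p q /= -[] q0.
  have {q0} -> : q = 0.
    by apply: quatP; move: q0 => /[dup] /(congr1 (@qre R)) + /[dup]
      /(congr1 (@qi R)) + /[dup] /(congr1 (@qj R)) + /(congr1 (@qk R));
      rewrite !qE => *; lra.
  by rewrite !mulr0.
rewrite vec_x; case: (ltrgt0P b) b_neq0 => // b0 _.
- by rewrite scalerA mulVf ?gt_eqF// scale1r.
- rewrite scalerA invrN mulNr mulVf ?lt_eqF// scaleN1r sF//=.
  by rewrite mulNr mulrN opprK.
Qed.

Lemma imag_unitN (J : quat R) : imag_units J -> imag_units (- J).
Proof. by rewrite /imag_units /= mulrNN. Qed.

Lemma imag_units_i : imag_units (mkquat 0 1 0 0 : quat R).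
Proof. by apply: quatP; rewrite !qE; ring. Qed.

Lemma induces_uniq D F G f : conj_invariant D ->
  induces D F f -> induces D G f -> forall z, D z -> F z = G z.
Proof.
move=> cD [sF fF] [sG fG] [a b] Dab.
have key J : imag_units J ->
    (F (a, b)).1 + J * (F (a, b)).2 = (G (a, b)).1 + J * (G (a, b)).2.
  move=> SJ; rewrite -(slice_funE sF Dab SJ) -(slice_funE sG Dab SJ).
  by rewrite -fF -?fG//; exists a, b, J.
pose I : quat R := mkquat 0 1 0 0.
have SI : imag_units I := imag_units_i.
have h1 := key _ SI; have h2 := key _ (imag_unitN SI).
move: h1 h2; case: (F (a, b)) => p q; case: (G (a, b)) => p' q' /= h1 h2.
have c (x y : quat R) (h : x = y) :
  [/\ qre x = qre y, qi x = qi y, qj x = qj y & qk x = qk y] by rewrite h.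
have [] := c _ _ h1; have [] := c _ _ h2; rewrite !qE => *.
by congr (_, _); apply: quatP; lra.
Qed.

Lemma induces_stem_of D F f : induces D F f -> induces D (stem_of D f) f.
Proof. exact: (@xgetI _ (fun=> 0) [set G | induces D G f] F). Qed.

Lemma circularizationT : circularization (@setT (R * R)) = setT.
Proof.
apply/seteqP; split => // x _; exists (qre x), (qimnorm x), (imag_dir x).
have s0 : 0 <= qi x ^+ 2 + qj x ^+ 2 + qk x ^+ 2 by rewrite !addr_ge0 ?sqr_ge0.
have nE : qimnorm x ^+ 2 = qi x ^+ 2 + qj x ^+ 2 + qk x ^+ 2 by rewrite sqr_sqrtr.
rewrite /imag_dir; have [n0|n0] := eqVneq (qimnorm x) 0.
  split => //; first exact: imag_units_i.
  move: nE; rewrite n0 expr0n /= => nE.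
  have := sqr_ge0 (qi x); have := sqr_ge0 (qj x); have := sqr_ge0 (qk x).
  move=> h3 h2 h1.
  apply: quatP; rewrite !qE; first by ring.
  - by transitivity (0 : R); [apply/eqP; rewrite -sqrf_eq0; apply/eqP; lra|ring].
  - by transitivity (0 : R); [apply/eqP; rewrite -sqrf_eq0; apply/eqP; lra|ring].
  - by transitivity (0 : R); [apply/eqP; rewrite -sqrf_eq0; apply/eqP; lra|ring].
split => //.
  rewrite /imag_units /=.
  have e : (qimnorm x)^-1 ^+ 2 * (qi x ^+ 2 + qj x ^+ 2 + qk x ^+ 2) = 1.
    by rewrite -nE -exprMn mulVf// expr1n.
  apply: quatP; rewrite !qE; by [ring|rewrite -e; ring].
by apply: quatP; rewrite !qE; field.
Qed.

End SliceFunctions.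

(* Main.v *)
(* Write [x = a + J b] and let [w = a + I b] in H (x) C, so that [w] is built from
   real coordinates and commutes with its own increments.  A series
   [sum x^n c_n / n!] with [|c_n| <= M r^n] is induced by the stem function
   [P_c(w) = sum w^n c_n / n!], and the second-order bound
   [|(w + h)^n - w^n - n w^(n-1) h| <= C n^2 B^n |h|^2] for commuting [w], [h] gives
   [|P_c(w + h) - P_c(w) - h P_(Sc)(w)| <= K |h|^2], where [Sc] is the shifted
   sequence.  Hence [P_c] is holomorphic with derivative [P_(Sc)].
   The coefficients of g satisfy [c_(n+1) = mu^n + c_n lambda], that is
   [g' = exp_mu + g lambda].  A slice-constant function has a stem whose partial
   derivatives both vanish, so multiplying by it on the left commutes with the
   slice derivative. *)
From HB Require Import structures.
Require Import Defs.
From mathcomp Require Import all_boot all_order all_algebra.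
From mathcomp Require Import all_classical all_reals all_analysis.
From mathcomp Require Import ring lra.
Import Order.TTheory GRing.Theory Num.Theory.
Import numFieldNormedType.Exports.
Local Open Scope classical_set_scope.
Local Open Scope ring_scope.
Set Implicit Arguments.
Unset Strict Implicit.
Unset Printing Implicit Defensive.

(** * Sup-norm estimates for products of quaternions and of elements of H (x) C *)

Section QuaternionNorm.
Variable R : realType.
Implicit Types (x y : quat R) (w t : quatC R).

Lemma quat_norm_le x (m : R) :
  (`|x| <= m) = [&& 0 <= m, `|qre x| <= m, `|qi x| <= m, `|qj x| <= m & `|qk x| <= m].
Proof.
apply/idP/idP => [xm|/and5P[m0 h0 h1 h2 h3]].
  have c i : `|x 0 i| <= m.
    apply: le_trans xm; rewrite [leRHS](mx_normrE (x : 'rV[R]_4)).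
    exact: (le_bigmax _ (fun ij : 'I_1 * 'I_4 => `|x ij.1 ij.2|) (0, i)).
  by rewrite !c (le_trans _ xm).
rewrite [leLHS](mx_normrE (x : 'rV[R]_4)); apply/bigmax_leP; split=> // -[i j] _ /=.
rewrite ord1; case: j => -[|[|[|[|//]]]] hi.
- by rewrite (_ : Ordinal hi = @Ordinal 4 0 isT) //; apply: val_inj.
- by rewrite (_ : Ordinal hi = @Ordinal 4 1 isT) //; apply: val_inj.
- by rewrite (_ : Ordinal hi = @Ordinal 4 2 isT) //; apply: val_inj.
- by rewrite (_ : Ordinal hi = @Ordinal 4 3 isT) //; apply: val_inj.
Qed.

(** Each coordinate of a product is a signed sum of four products of coordinates, whence the factor
    4; the sup norm is only submultiplicative up to a constant. *)
Lemma quat_normM x y : `|x * y| <= 4 * `|x| * `|y|.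
Proof.
have := lexx `|x|; rewrite {1}quat_norm_le => /and5P[x0 x1 x2 x3 x4].
have := lexx `|y|; rewrite {1}quat_norm_le => /and5P[y0 y1 y2 y3 y4].
(* The three booleans carry the signs, so that one estimate serves all four coordinates. *)
have sum4 (a b c d e f g h : R) :
    `|a| <= `|x| -> `|b| <= `|y| -> `|c| <= `|x| -> `|d| <= `|y| ->
    `|e| <= `|x| -> `|f| <= `|y| -> `|g| <= `|x| -> `|h| <= `|y| ->
    forall s1 s2 s3 : bool,
    `|a * b + (-1) ^+ s1 * (c * d) + (-1) ^+ s2 * (e * f) + (-1) ^+ s3 * (g * h)|
      <= 4 * `|x| * `|y|.
  move=> ax bY cx dy ex fy gx hy s1 s2 s3.
  apply: le_trans (ler_normD _ _) _; apply: le_trans (lerD (ler_normD _ _) (lexx _)) _.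
  apply: le_trans (lerD (lerD (ler_normD _ _) (lexx _)) (lexx _)) _.
  rewrite !normrM !normrX !normrN1 !expr1n !mul1r.
  have -> : 4 * `|x| * `|y| = `|x| * `|y| + `|x| * `|y| + `|x| * `|y| + `|x| * `|y|.
    by ring.
  by rewrite !lerD// ler_pM.
rewrite quat_norm_le !mulr_ge0//= qreM qiM qjM qkM; apply/and4P; split.
- have := sum4 _ _ _ _ _ _ _ _ x1 y1 x2 y2 x3 y3 x4 y4 true true true.
  by rewrite !expr1 !mulN1r.
- have := sum4 _ _ _ _ _ _ _ _ x1 y2 x2 y1 x3 y4 x4 y3 false false true.
  by rewrite !expr1 !expr0 !mulN1r !mul1r.
- have := sum4 _ _ _ _ _ _ _ _ x1 y3 x2 y4 x3 y1 x4 y2 true false false.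
  by rewrite !expr1 !expr0 !mulN1r !mul1r.
- have := sum4 _ _ _ _ _ _ _ _ x1 y4 x2 y3 x3 y2 x4 y1 false true false.
  by rewrite !expr1 !expr0 !mulN1r !mul1r.
Qed.

Lemma quat_norm_one : `|1 : quat R| <= 1.
Proof. by rewrite quat_norm_le qre1 qi1 qj1 qk1 normr0 normr1 ler01 lexx. Qed.

Lemma quatC_norm_le w (m : R) : (`|w| <= m) = (`|w.1| <= m) && (`|w.2| <= m).
Proof. by rewrite prod_normE ge_max. Qed.

Lemma quatC_norm1 w : `|w.1| <= `|w|.
Proof. by have := lexx `|w|; rewrite {1}quatC_norm_le => /andP[]. Qed.

Lemma quatC_norm2 w : `|w.2| <= `|w|.
Proof. by have := lexx `|w|; rewrite {1}quatC_norm_le => /andP[]. Qed.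

Lemma quatC_mulE w t : w * t = (w.1 * t.1 - w.2 * t.2, w.1 * t.2 + w.2 * t.1).
Proof. by []. Qed.

(** Each component involves two quaternion products, so the factor 4 doubles. *)
Lemma quatC_normM w t : `|w * t| <= 8 * `|w| * `|t|.
Proof.
have M (x y : quat R) : `|x| <= `|w| -> `|y| <= `|t| -> `|x * y| <= 4 * `|w| * `|t|.
  move=> xw yt; apply: le_trans (quat_normM _ _) _.
  by rewrite ler_pM ?mulr_ge0// ler_pM2l.
have w1 := quatC_norm1 w; have w2 := quatC_norm2 w.
have t1 := quatC_norm1 t; have t2 := quatC_norm2 t.
have e : 8 * `|w| * `|t| = 4 * `|w| * `|t| + 4 * `|w| * `|t| by ring.
rewrite quatC_mulE quatC_norm_le e /=; apply/andP; split.
  by apply: le_trans (ler_normB _ _) _; rewrite lerD// M.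
by apply: le_trans (ler_normD _ _) _; rewrite lerD// M.
Qed.

End QuaternionNorm.

(** * Limits of products, dominated series and their tails *)

Section Limits.
Variables (R : realType).

Lemma norm_le_cvg (V : normedModType R) (T : Type) (F : set_system T)
    (FF : Filter F) (f : T -> V) (l : V) (u : T -> R) :
  (\forall x \near F, `|f x - l| <= u x) -> u @ F --> (0 : R) -> f @ F --> l.
Proof.
move=> fu u0; apply/subr_cvg0; apply: norm_cvg0.
apply: (squeeze_cvgr _ (cvg_cst 0) u0).
by apply: filterS fu => x ->; rewrite normr_ge0.
Qed.

Lemma cvg_norm_sub (V : normedModType R) (T : Type) (F : set_system T)
    (FF : Filter F) (f : T -> V) (l : V) :
  f @ F --> l -> `|f x - l| @[x --> F] --> (0 : R).
Proof.
by move=> fl; rewrite -(normr0 V); apply: cvg_norm; apply/subr_cvg0.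
Qed.

(** Follows from [quatC_normM] and the expansion f g - a b = (f - a)(g - b) + a (g - b) + (f - a)
    b. *)
Lemma cvg_quatCM (T : Type) (F : set_system T) (FF : Filter F)
    (f g : T -> quatC R) (a b : quatC R) :
  f @ F --> a -> g @ F --> b -> f x * g x @[x --> F] --> a * b.
Proof.
move=> /cvg_norm_sub fa0 /cvg_norm_sub gb0.
pose u x : R := 8 * `|f x - a| * `|g x - b| + 8 * `|a| * `|g x - b| + 8 * `|f x - a| * `|b|.
apply: (@norm_le_cvg _ _ _ _ _ _ u).
  apply: nearW => x.
  have -> : f x * g x - a * b = (f x - a) * (g x - b) + a * (g x - b) + (f x - a) * b.
    by rewrite -mulrDl subrK mulrBr mulrBl addrA subrK.
  apply: le_trans (ler_normD _ _) _; apply: lerD; last exact: quatC_normM.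
  by apply: le_trans (ler_normD _ _) _; apply: lerD; exact: quatC_normM.
rewrite (_ : 0 = 8 * 0 * 0 + 8 * `|a| * 0 + 8 * 0 * `|b|) /u.
  apply: cvgD; first apply: cvgD; apply: cvgM => //; try exact: cvg_cst.
  - by apply: cvgM => //; exact: cvg_cst.
  - by apply: cvgM => //; exact: cvg_cst.
by rewrite !(mulr0, mul0r, addr0).
Qed.

Lemma cvg_norm_le (V : normedModType R) (u : V^nat) (l : V) (m : R) :
  u @ \oo --> l -> (forall n, `|u n| <= m) -> `|l| <= m.
Proof.
move=> ul um; apply: (@ler_cvg_to _ \oo _ R (fun n => `|u n|) (fun=> m)).
- exact: cvg_norm.
- exact: cvg_cst.
- by apply: nearW => n; exact: um.
Qed.

Lemma bounded_series (v : R^nat) : (forall n, 0 <= v n) -> cvgn (series v) ->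
  exists2 S : R, 0 <= S & forall n, series v n <= S.
Proof.
move=> v0 cv; have vle : forall n, series v n <= limn (series v).
  by apply: nondecreasing_cvgn_le => //; exact: nondecreasing_series.
exists (limn (series v)) => //; apply: le_trans (vle 0%N).
by rewrite /series /= big_geq.
Qed.

Lemma series_fst (u : (quatC R)^nat) n : (series u n).1 = series (fun k => (u k).1) n.
Proof. by rewrite /series /= (big_morph (fun w : quatC R => w.1) (id1 := 0) (op1 := +%R)). Qed.

Lemma series_snd (u : (quatC R)^nat) n : (series u n).2 = series (fun k => (u k).2) n.
Proof. by rewrite /series /= (big_morph (fun w : quatC R => w.2) (id1 := 0) (op1 := +%R)). Qed.

Lemma dominated_series_cvg (V : completeNormedModType R) (u : V^nat) (v : R^nat) :
  (forall n, `|u n| <= v n) -> cvgn (series v) -> cvgn (series u).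
Proof.
move=> uv cv; apply: normed_cvg; apply: (@series_le_cvg _ _ v _ _ _ cv) => n /=.
- exact: normr_ge0.
- exact: le_trans (normr_ge0 _) (uv n).
- exact: uv.
Qed.

(** Completeness is used in [quat R]: the two components are summed separately and then paired. *)
Lemma quatC_dominated_series_cvg (u : (quatC R)^nat) (v : R^nat) :
  (forall n, `|u n| <= v n) -> cvgn (series v) -> cvgn (series u).
Proof.
move=> uv cv.
have c1 : cvgn (series (fun k => (u k).1)).
  by apply: (@dominated_series_cvg (quat R) _ v) => // n; exact: le_trans (quatC_norm1 _) (uv n).
have c2 : cvgn (series (fun k => (u k).2)).
  by apply: (@dominated_series_cvg (quat R) _ v) => // n; exact: le_trans (quatC_norm2 _) (uv n).
rewrite (_ : series u = fun n => (series (fun k => (u k).1) n, series (fun k => (u k).2) n)).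
  apply/cvg_ex; exists (limn (series (fun k => (u k).1)), limn (series (fun k => (u k).2))).
  exact: (cvg_pair c1 c2).
by apply/funext => n; rewrite -series_fst -series_snd; case: (series u n).
Qed.

(** The bound involves only the majorant [v]. If [u] depends on a parameter and [v] does not,
    convergence is therefore uniform in that parameter. *)
Lemma dominated_series_tail (V : normedModType R) (u : V^nat) (v : R^nat) (l : V) N :
  (forall n, `|u n| <= v n) -> series u @ \oo --> l -> cvgn (series v) ->
  `|l - series u N| <= limn (series v) - series v N.
Proof.
move=> uv ul cv.
have cN : series u n - series u N @[n --> \oo] --> l - series u N.
  by apply: cvgB => //; exact: cvg_cst.
have vN : series v n - series v N @[n --> \oo] --> limn (series v) - series v N.
  by apply: cvgB => //; exact: cvg_cst.
apply: (@ler_cvg_to _ \oo _ R (fun n => `|series u n - series u N|)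
  (fun n => series v n - series v N)) => //; first exact: cvg_norm.
near=> n.
have Nn : (N <= n)%N by near: n; exists N.
rewrite !sub_series_geq//; apply: le_trans (ler_norm_sum _ _ _) _.
exact: ler_sum.
Unshelve. all: by end_near. Qed.

End Limits.

(** * The real algebra structure of H (x) C *)

Section ComplexifiedAlgebra.
Variable R : realType.
Implicit Types (w t : quatC R) (a : R).

(* The cast selects the product of [quatC] rather than the componentwise one. *)
Lemma quatC_scaleAl a w t : a *: (w * t) = (a *: w : quatC R) * t.
Proof.
rewrite !quatC_mulE.
transitivity (a *: (w.1 * t.1 - w.2 * t.2), a *: (w.1 * t.2 + w.2 * t.1)) => //.
by rewrite scalerBr scalerDr !scalerAl.
Qed.

Lemma quatC_scaleAr a w t : a *: (w * t) = w * (a *: t : quatC R).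
Proof.
rewrite !quatC_mulE.
transitivity (a *: (w.1 * t.1 - w.2 * t.2), a *: (w.1 * t.2 + w.2 * t.1)) => //.
by rewrite scalerBr scalerDr !scalerAr.
Qed.

End ComplexifiedAlgebra.

HB.instance Definition _ (R : realType) :=
  GRing.Lmodule_isLalgebra.Build R (quatC R) (@quatC_scaleAl R).
HB.instance Definition _ (R : realType) :=
  GRing.Lalgebra_isAlgebra.Build R (quatC R) (@quatC_scaleAr R).

(** * Exponential-type series in H (x) C and their second-order Taylor bound *)

Section ExponentialSeries.
Variable R : realType.
Implicit Types (w h t : quatC R) (c : (quatC R)^nat) (a : R).

Lemma quatC_norm_one : `|1 : quatC R| <= 1.
Proof.
by rewrite quatC_norm_le normr0 ler01 andbT /= quat_norm_one.
Qed.

(** Each multiplication by [w] costs a factor 8 |w|, which [B] absorbs; this is why the radii below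
    appear in the form 8 |w| <= B. *)
Lemma quatC_normX w n (B : R) : 8 * `|w| <= B -> `|w ^+ n| <= B ^+ n.
Proof.
move=> wB; elim: n => [|n IH]; first exact: quatC_norm_one.
rewrite !exprS; apply: le_trans (quatC_normM _ _) _.
by rewrite ler_pM ?mulr_ge0.
Qed.

Definition exp_term c w n : quatC R := n`!%:R^-1 *: (w ^+ n * c n).

Definition exp_series c w : quatC R := limn (series (exp_term c w)).

(** This growth is preserved by shifting the sequence, and the factorials turn it into convergence
    at every point of H (x) C. *)
Definition geom_bounded c := exists2 M : R, 0 <= M &
  exists2 r : R, 0 <= r & forall n, `|c n| <= M * r ^+ n.

Lemma geom_bounded_shift c : geom_bounded c -> geom_bounded (fun n => c n.+1).
Proof.
move=> [M M0 [r r0 cr]]; exists (M * r); first exact: mulr_ge0.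
by exists r => // n; rewrite -mulrA -exprS.
Qed.

(** The majorant depends on [w] only through [B], so it serves a whole ball at once. *)
Lemma exp_term_le c w (M r B : R) n : 0 <= M -> 0 <= r ->
  `|c n| <= M * r ^+ n -> 8 * `|w| <= B ->
  `|exp_term c w n| <= 8 * M * exp_coeff (B * r) n.
Proof.
move=> M0 r0 cn wB; have B0 : 0 <= B by apply: le_trans wB; rewrite mulr_ge0.
rewrite /exp_term /exp_coeff /= normrZ ger0_norm ?invr_ge0//.
apply: le_trans (ler_wpM2l _ (quatC_normM _ _)) _; first by rewrite invr_ge0.
rewrite exprMn (_ : 8 * M * (B ^+ n * r ^+ n / n`!%:R) =
  n`!%:R^-1 * (8 * B ^+ n * (M * r ^+ n))); last by ring.
apply: ler_wpM2l; first by rewrite invr_ge0.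
rewrite ler_pM// ?mulr_ge0//; apply: ler_wpM2l => //; exact: quatC_normX.
Qed.

Lemma exp_series_cvg c w : geom_bounded c ->
  series (exp_term c w) @ \oo --> exp_series c w.
Proof.
move=> [M M0 [r r0 cr]].
apply: (@quatC_dominated_series_cvg _ _ ((8 * M) *: exp_coeff (8 * `|w| * r))).
  by move=> n; apply: exp_term_le.
by apply: is_cvg_seriesZ; exact: is_cvg_series_exp_coeff.
Qed.

Lemma exp_series_tail c (B : R) : 0 <= B -> geom_bounded c ->
  forall e : R, 0 < e -> \forall N \near \oo, forall w, 8 * `|w| <= B ->
  `|exp_series c w - series (exp_term c w) N| <= e.
Proof.
move=> B0 gc e e0; have [M M0 [r r0 cr]] := gc.
pose v : R^nat := (8 * M) *: exp_coeff (B * r).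
have cv : cvgn (series v) by apply: is_cvg_seriesZ; exact: is_cvg_series_exp_coeff.
have /cvgrPdist_le/(_ _ e0) := cv; apply: filterS => N vN w wB.
apply: le_trans (le_trans (ler_norm _) vN).
apply: dominated_series_tail => //; last exact: exp_series_cvg.
by move=> n; apply: exp_term_le.
Qed.

(* For [n = 0] the truncated exponent [n.-1] is harmless: the last term is [*+ 0]. *)
Definition taylor_rem w h n : quatC R :=
  (w + h) ^+ n - w ^+ n - (w ^+ n.-1 * h) *+ n.

(** Multiplying the previous remainder by w + h reproduces the new one, except for the cross terms
    w^n h^2 created by the linear part; commutation of [w] and [h] lets the other linear terms
    merge. *)
Lemma taylor_remS w h n : w * h = h * w ->
  taylor_rem w h n.+2 = (w + h) * taylor_rem w h n.+1 + (w ^+ n * (h * h)) *+ n.+1.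
Proof.
move=> wh; have whX k : h * w ^+ k = w ^+ k * h by apply: commrX.
have e1 : (w + h) * w ^+ n.+1 = w ^+ n.+2 + w ^+ n.+1 * h.
  by rewrite mulrDl -exprS whX.
have e2 : (w + h) * (w ^+ n * h) = w ^+ n.+1 * h + w ^+ n * (h * h).
  by rewrite mulrDl !mulrA -exprS whX.
rewrite /taylor_rem /= !mulrBr e1 mulrnAr e2 mulrnDl.
have telescope (V : zmodType) (X Y Z U : V) m :
    X - Y - Z *+ m.+1 = X - (Y + Z) - (Z *+ m + U) + U.
  by rewrite mulrS !opprD !addrA subrK.
by rewrite -exprS; exact: telescope.
Qed.

(** The remainder vanishes for n = 0 and n = 1, and [taylor_remS] propagates the bound. The factor 8
    * 8 pays for the two products in w^n (h h), and 1 <= B raises B^n to the common power. *)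
Lemma taylor_rem_le w h n (B : R) : w * h = h * w -> 1 <= B ->
  8 * `|w| <= B -> 8 * `|w + h| <= B ->
  `|taylor_rem w h n| <= 8 * 8 * `|h| ^+ 2 * (n%:R ^+ 2 * B ^+ n).
Proof.
move=> wh B1 wB whB; have B0 : 0 <= B by exact: le_trans B1.
case: n => [|n].
  by rewrite /taylor_rem !expr0 subrr mulr0n subr0 normr0 expr0n mul0r mulr0.
elim: n => [|n IH].
  rewrite /taylor_rem !expr1 expr0 mul1r mulr1n [w + h]addrC addrK subrr normr0.
  by rewrite !mulr_ge0.
rewrite taylor_remS//; apply: le_trans (ler_normD _ _) _.
have h1 : `|(w + h) * taylor_rem w h n.+1| <=
    B * (8 * 8 * `|h| ^+ 2 * (n.+1%:R ^+ 2 * B ^+ n.+1)).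
  by apply: le_trans (quatC_normM _ _) _; rewrite ler_pM ?mulr_ge0.
have h2 : `|(w ^+ n * (h * h)) *+ n.+1| <= n.+1%:R * (8 * 8 * `|h| ^+ 2 * B ^+ n.+2).
  rewrite normrMn -[leLHS]mulr_natl; apply: ler_wpM2l => //.
  apply: le_trans (quatC_normM _ _) _.
  apply: (@le_trans _ _ (8 * B ^+ n * (8 * `|h| * `|h|))).
    by rewrite ler_pM ?quatC_normM ?mulr_ge0// ler_wpM2l ?quatC_normX.
  rewrite (_ : 8 * B ^+ n * (8 * `|h| * `|h|) = 8 * 8 * `|h| ^+ 2 * B ^+ n); last by ring.
  apply: ler_wpM2l; first by rewrite mulr_ge0 ?exprn_ge0.
  by apply: ler_weXn2l => //; rewrite leqW.
apply: le_trans (lerD h1 h2) _.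
have hB : 0 <= `|h| ^+ 2 * B ^+ n.+2 by rewrite mulr_ge0// exprn_ge0.
have n0 : 0 <= (n.+1%:R : R) by [].
rewrite (_ : n.+2%:R = n.+1%:R + 1 :> R); last by rewrite natr1.
rewrite [B ^+ n.+2]exprS in hB *; move: (B ^+ n.+1) (n.+1%:R) hB n0 => b m hB m0.
rewrite -subr_ge0; move: (`|h| ^+ 2) hB => k hB.
(* The slack in the induction is (m + 1)^2 - m^2 - m = m + 1. *)
have -> : 8 * 8 * k * ((m + 1) ^+ 2 * (B * b))
    - (B * (8 * 8 * k * (m ^+ 2 * b)) + m * (8 * 8 * k * (B * b)))
  = 8 * 8 * (m + 1) * (k * (B * b)) by ring.
by apply: mulr_ge0 => //; rewrite mulr_ge0 ?addr_ge0.
Qed.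

(** The constant depends on [c] and [B] but not on the point or the increment. The estimate is
    proved for partial sums and passes to the limit. *)
Lemma exp_series_taylor c (B : R) : geom_bounded c -> 1 <= B ->
  exists2 K : R, 0 <= K & forall w h, w * h = h * w ->
  8 * `|w| <= B -> 8 * `|w + h| <= B ->
  `|exp_series c (w + h) - exp_series c w - h * exp_series (fun n => c n.+1) w|
    <= K * `|h| ^+ 2.
Proof.
move=> gc B1; have [M M0 [r r0 cr]] := gc.
have B0 : 0 <= B by exact: le_trans B1.
(* The factor 4 absorbs the n^2 of [taylor_rem_le]: since n < 2^n, n^2 <= 4^n. *)
pose v : R^nat := exp_coeff (4 * B * r).
have v0 n : 0 <= v n by rewrite /v exp_coeff_ge0// !mulr_ge0.
have cv : cvgn (series v) by exact: is_cvg_series_exp_coeff.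
have [S S0 vS] := bounded_series v0 cv.
exists (8 * 8 * 8 * M * S); first by rewrite !mulr_ge0.
move=> w h wh wB whB.
(* The first two sums have one term more: their terms at 0 cancel, and term n + 1 of their
   difference is matched with term n of the shifted series. *)
pose d N := series (exp_term c (w + h)) N.+1 - series (exp_term c w) N.+1
  - h * series (exp_term (fun n => c n.+1) w) N.
have dE N : d N = \sum_(0 <= n < N.+1) n`!%:R^-1 *: (taylor_rem w h n * c n).
  rewrite /d /series /= [RHS]big_nat_recl// /taylor_rem !expr0 subrr mulr0n subr0.
  rewrite mul0r scaler0 add0r -sumrB big_nat_recl// /exp_term !expr0 subrr add0r.
  rewrite mulr_sumr -sumrB; apply: eq_bigr => n _.
  rewrite !mulrBl !scalerBr -scalerAr; congr (_ - _).
  rewrite mulrA -commrX; last by rewrite /GRing.comm.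
  by rewrite mulrnAl -[X in _ = _ *: X]scaler_nat scalerA factS natrM invfM mulrAC mulVf ?mul1r//.
have dcvg : d N @[N --> \oo] -->
    exp_series c (w + h) - exp_series c w - h * exp_series (fun n => c n.+1) w.
  apply: cvgB; first apply: cvgB.
  - by rewrite (cvg_shiftS (series (exp_term c (w + h)))); exact: exp_series_cvg.
  - by rewrite (cvg_shiftS (series (exp_term c w))); exact: exp_series_cvg.
  - apply: cvg_quatCM; first exact: cvg_cst.
    exact/exp_series_cvg/geom_bounded_shift.
apply: (cvg_norm_le dcvg) => N; rewrite dE.
apply: le_trans (ler_norm_sum _ _ _) _.
apply: (@le_trans _ _ (8 * 8 * 8 * M * `|h| ^+ 2 * series v N.+1)); last first.
  rewrite [leRHS]mulrAC; apply: ler_wpM2l; last exact: vS.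
  by apply: mulr_ge0; [exact: mulr_ge0 | exact: exprn_ge0].
rewrite /series /= mulr_sumr; apply: ler_sum => n _.
rewrite normrZ ger0_norm ?invr_ge0// /v /exp_coeff /=.
apply: (@le_trans _ _ (n`!%:R^-1 * (8 * (8 * 8 * `|h| ^+ 2 * (4 ^+ n * B ^+ n)) * (M * r ^+ n)))).
  apply: ler_wpM2l; first by rewrite invr_ge0.
  apply: le_trans (quatC_normM _ _) _.
  rewrite ler_pM ?mulr_ge0//; apply: ler_wpM2l => //.
  apply: le_trans (taylor_rem_le _ wh B1 wB whB) _.
  apply: ler_wpM2l; first by rewrite mulr_ge0.
  apply: ler_wpM2r; first exact: exprn_ge0.
  rewrite (_ : 4 = 2 ^+ 2 :> R); last by rewrite expr2 -natrM.
  rewrite -exprM mulnC exprM; apply: lerXn2r; rewrite ?nnegrE ?exprn_ge0//.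
  by rewrite -natrX ler_nat ltnW// ltn_expl.
by rewrite !exprMn le_eqVlt; apply/orP; left; apply/eqP; ring.
Qed.

End ExponentialSeries.

(** * Directional derivatives from a quadratic error bound *)

Section Derivatives.
Variables (R : realType) (V W : normedModType R).

Lemma is_deriveP (f : V -> W) (a v : V) (l : W) :
  is_derive a v f l <-> h^-1 *: (f (h *: v + a) - f a) @[h --> (0 : R)^'] --> l.
Proof.
split=> [[fav <-]|fl]; first exact: fav.
by split; [apply: cvgP fl | exact: cvg_lim fl].
Qed.

Lemma quadratic_is_derive (f : V -> W) (a v : V) (l : W) (K : R) :
  (forall h : R, `|h| <= 1 -> `|f (h *: v + a) - f a - h *: l| <= K * `|h| ^+ 2) ->
  is_derive a v f l.
Proof.
move=> fK; apply/is_deriveP.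
apply: (@norm_le_cvg _ _ _ _ _ _ _ (fun h : R => K * `|h|)).
  near=> h.
  have h0 : h != 0 by near: h; exact: nbhs_dnbhs_neq.
  have h1 : `|h| <= 1 by near: h; apply: dnbhs0_le.
  rewrite -[X in _ - X](scalerK h0) -scalerBr normrZ normfV mulrC ler_pdivrMr ?normr_gt0//.
  by rewrite -mulrA -expr2 fK.
have : K * `|h| @[h --> (0 : R)^'] --> K * `|(0 : R)|.
  apply: cvgM; first exact: cvg_cst.
  by apply: cvg_norm; apply: cvg_within.
by rewrite normr0 mulr0.
Unshelve. all: by end_near. Qed.

End Derivatives.

(** * Exponential series as differentiable functions on the complex plane *)

Section ExponentialStem.
Variable R : realType.
Implicit Types (z v : R * R) (c : (quatC R)^nat).

Definition cplx z : quatC R := (z.1%:A, z.2%:A).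

Lemma cplxD z v : cplx (z + v) = cplx z + cplx v.
Proof. by rewrite /cplx /= !scalerDl. Qed.

Lemma cplxZ (a : R) z : cplx (a *: z) = a *: cplx z.
Proof. by rewrite /cplx /= -!scalerA. Qed.

Lemma cplxC z v : cplx z * cplx v = cplx v * cplx z.
Proof.
rewrite !quatC_mulE /=; congr (_, _); rewrite -!scalerAl !mul1r !scalerA.
  by rewrite mulrC [z.2 * _]mulrC.
by rewrite addrC mulrC [z.1 * _]mulrC.
Qed.

Lemma cplx_cvg z : cplx t @[t --> z] --> cplx z.
Proof.
have c1 : (t.1%:A : quat R) @[t --> z] --> (z.1%:A : quat R).
  by apply: cvgZl; exact: cvg_fst.
have c2 : (t.2%:A : quat R) @[t --> z] --> (z.2%:A : quat R).
  by apply: cvgZl; exact: cvg_snd.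
exact: (cvg_pair c1 c2).
Qed.

Definition exp_stem c z := exp_series c (cplx z).

(** The Taylor bound applies because all values of [cplx], hence the point and its increment,
    commute. *)
Lemma is_derive_exp_stem c z v : geom_bounded c ->
  is_derive z v (exp_stem c) (cplx v * exp_stem (fun n => c n.+1) z).
Proof.
(* This [B] is at least 1 and bounds 8 |cplx z + h cplx v| whenever |h| <= 1. *)
move=> gc; pose B : R := 1 + 8 * `|cplx z| + 8 * `|cplx v|.
have B1 : 1 <= B by rewrite /B -addrA lerDl addr_ge0 ?mulr_ge0.
have [K K0 KP] := exp_series_taylor gc B1.
apply: (@quadratic_is_derive _ _ _ _ _ _ _ (K * `|cplx v| ^+ 2)) => h h1.
have zv : cplx z * (h *: cplx v) = h *: cplx v * cplx z by rewrite -cplxZ cplxC.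
have zB : 8 * `|cplx z| <= B by rewrite /B addrAC lerDr addr_ge0 ?mulr_ge0.
have zvB : 8 * `|cplx z + h *: cplx v| <= B.
  have := ler_normD (cplx z) (h *: cplx v); rewrite normrZ.
  by have := ler_piMl (normr_ge0 (cplx v)) h1; rewrite /B; lra.
have := KP _ _ zv zB zvB; rewrite normrZ exprMn => KPh.
rewrite /exp_stem cplxD cplxZ [_ + cplx z]addrC scalerAl.
by apply: le_trans KPh _; rewrite le_eqVlt; apply/orP; left; apply/eqP; ring.
Qed.

(** Directional derivatives alone do not give continuity, so the Taylor bound is applied to the full
    increment; for |h| <= 1 its square is at most |h|. *)
Lemma exp_stem_continuous c : geom_bounded c -> continuous (exp_stem c).
Proof.
(* The room left in [B] admits every increment of norm at most 1. *)
move=> gc z; pose B : R := 9 + 8 * `|cplx z|.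
have B1 : 1 <= B by rewrite /B; have := normr_ge0 (cplx z); lra.
have [K K0 KP] := exp_series_taylor gc B1.
have h0 : `|cplx t - cplx z| @[t --> z] --> (0 : R).
  by apply: cvg_norm_sub; exact: cplx_cvg.
pose P := exp_stem (fun n => c n.+1) z.
apply: (@norm_le_cvg _ _ _ _ _ _ _ (fun t => (8 * `|P| + K) * `|cplx t - cplx z|)).
  near=> t.
  have t1 : `|cplx t - cplx z| <= 1.
    near: t; move/cvgr0_norm_le : h0 => /(_ 1 ltr01); apply: filterS => t.
    by rewrite normr_id.
  set h := cplx t - cplx z in t1 *.
  have tE : exp_stem c t = exp_series c (cplx z + h) by rewrite addrC subrK.
  have zh : cplx z * h = h * cplx z by rewrite /h mulrBr mulrBl cplxC.
  have zB : 8 * `|cplx z| <= B by rewrite /B lerDr.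
  have zhB : 8 * `|cplx z + h| <= B.
    by have := ler_normD (cplx z) h; rewrite /B; lra.
  rewrite tE -[X in `|X|](subrK (h * P)) [leRHS]mulrDl [8 * `|P| * _]mulrAC.
  apply: le_trans (ler_normD _ _) _; rewrite [leRHS]addrC.
  apply: lerD; last exact: quatC_normM.
  apply: le_trans (KP _ _ zh zB zhB) _; apply: (ler_wpM2l K0).
  by rewrite expr2; exact: ler_piMr.
have : (8 * `|P| + K) * `|cplx t - cplx z| @[t --> z] --> (8 * `|P| + K) * 0.
  by apply: cvgM => //; exact: cvg_cst.
by rewrite mulr0.
Unshelve. all: by end_near. Qed.

End ExponentialStem.

(** * From series in H (x) C to quaternionic power series *)

Section SliceSeries.
Variable R : realType.
Implicit Types (x lambda mu : quat R) (d : (quat R)^nat) (w : quatC R) (z : R * R).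

Definition slice_pt x : R * R := (qre x, qimnorm x).

(** For fixed [x] this map is real-linear and continuous, commutes with right multiplication by
    quaternions, and turns left multiplication by [cplx (slice_pt x)] into left multiplication by
    [x]. It thus carries power series in H (x) C to power series in H. *)
Definition slice_eval x w : quat R := w.1 + imag_dir x * w.2.

Lemma slice_funP F x : slice_fun F x = slice_eval x (F (slice_pt x)).
Proof. by []. Qed.

Lemma slice_evalD x w t : slice_eval x (w + t) = slice_eval x w + slice_eval x t.
Proof. by rewrite /slice_eval /= mulrDr addrACA. Qed.

Lemma slice_evalB x w t : slice_eval x (w - t) = slice_eval x w - slice_eval x t.
Proof. by rewrite /slice_eval /= mulrBr opprD addrACA. Qed.

Lemma slice_evalZ x (a : R) w : slice_eval x (a *: w) = a *: slice_eval x w.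
Proof. by rewrite /slice_eval /= scalerDr scalerAr. Qed.

Lemma slice_evalMr x w (q : quat R) : slice_eval x (w * (q, 0)) = slice_eval x w * q.
Proof. by rewrite /slice_eval quatC_mulE /= !mulr0 subr0 add0r mulrDl mulrA. Qed.

Lemma slice_eval_sum x (u : nat -> quatC R) n :
  slice_eval x (\sum_(0 <= k < n) u k) = \sum_(0 <= k < n) slice_eval x (u k).
Proof.
apply: (big_morph (slice_eval x)); first exact: slice_evalD.
by rewrite /slice_eval mulr0 addr0.
Qed.

Lemma qimnorm_sqr x : qimnorm x ^+ 2 = qi x ^+ 2 + qj x ^+ 2 + qk x ^+ 2.
Proof. by rewrite sqr_sqrtr// !addr_ge0 ?sqr_ge0. Qed.

Lemma imag_dir_unit x : imag_units (imag_dir x).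
Proof.
rewrite /imag_dir; case: eqVneq => [_|n0]; first exact: imag_units_i.
have e : (qimnorm x)^-1 ^+ 2 * (qi x ^+ 2 + qj x ^+ 2 + qk x ^+ 2) = 1.
  by rewrite -qimnorm_sqr -exprMn mulVf// expr1n.
by apply: quatP; rewrite !qE; [rewrite -e; ring | ring | ring | ring].
Qed.

Lemma slice_fun_cplx x : slice_fun (@cplx R) x = x.
Proof.
have : circularization setT x by rewrite circularizationT.
move=> [a [b [J [_ SJ ->]]]]; rewrite (@slice_funE _ setT)// /cplx /=.
  by rewrite -scalerAr mulr1.
by move=> c e _; rewrite /qCconj /= scaleNr.
Qed.

(** With x = a + J b and J^2 = -1, (a + J b)(p + J q) = (a p - b q) + J (b p + a q), as the real
    numbers a and b commute with everything. *)
Lemma slice_eval_cplxM x w : slice_eval x (cplx (slice_pt x) * w) = x * slice_eval x w.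
Proof.
have JJ : imag_dir x * imag_dir x = -1 := imag_dir_unit x.
have := slice_fun_cplx x; rewrite slice_funP /slice_eval /cplx /slice_pt /=.
rewrite mulr_algr; move: (qre x) (qimnorm x) (imag_dir x) JJ => a b J JJ <-.
rewrite !mulr_algl mulrDl mulr_algl mulrDr !scalerDr -!scalerAl -!scalerAr mulrDr mulrA JJ.
by rewrite mulN1r scalerBr addrACA [- _ + _]addrC.
Qed.

Lemma imag_dir_norm x : `|imag_dir x| <= 1.
Proof.
have [J0 J1] := imag_unitE (imag_dir_unit x).
have sq (a : R) : a ^+ 2 <= 1 -> `|a| <= 1
  by rewrite -[a ^+ 2]real_normK ?num_real// expr_le1.
have h1 := sqr_ge0 (qi (imag_dir x)); have h2 := sqr_ge0 (qj (imag_dir x)).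
have h3 := sqr_ge0 (qk (imag_dir x)).
by rewrite quat_norm_le ler01 J0 normr0 ler01 !sq//; lra.
Qed.

Lemma slice_eval_norm x w : `|slice_eval x w| <= 5 * `|w|.
Proof.
have w1 := quatC_norm1 w; have w2 := quatC_norm2 w.
apply: le_trans (ler_normD _ _) _.
apply: (@le_trans _ _ (`|w| + 4 * `|w|)); last by lra.
rewrite lerD//; apply: le_trans (quat_normM _ _) _.
by rewrite ler_pM ?mulr_ge0// ler_piMr// imag_dir_norm.
Qed.

Lemma slice_eval_cvg (u : (quatC R)^nat) x w :
  u @ \oo --> w -> slice_eval x (u n) @[n --> \oo] --> slice_eval x w.
Proof.
move=> /cvg_norm_sub u0.
apply: (@norm_le_cvg _ _ _ _ _ _ _ (fun n => 5 * `|u n - w|)).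
  by apply: nearW => n; rewrite -slice_evalB slice_eval_norm.
have : 5 * `|u n - w| @[n --> \oo] --> (5 : R) * 0.
  by apply: cvgM => //; exact: cvg_cst.
by rewrite mulr0.
Qed.

(** Real with respect to the factor C: the coefficients are quaternions, fixed by [qCconj]. *)
Definition real_coef d : (quatC R)^nat := fun n => (d n, 0).

Definition qterm d x n : quat R := n`!%:R^-1 *: (x ^+ n * d n).

Lemma qterm_slice d x n :
  qterm d x n = slice_eval x (exp_term (real_coef d) (cplx (slice_pt x)) n).
Proof.
rewrite /exp_term slice_evalZ slice_evalMr; congr (_ *: (_ * _)).
elim: n => [|n IH]; first by rewrite !expr0 /slice_eval mulr0 addr0.
by rewrite !exprS slice_eval_cplxM IH.
Qed.

Lemma series_qterm d x N : series (qterm d x) N =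
  slice_eval x (series (exp_term (real_coef d) (cplx (slice_pt x))) N).
Proof.
by rewrite /series /= slice_eval_sum; apply: eq_bigr => n _; exact: qterm_slice.
Qed.

Lemma qterm_cvg d x : geom_bounded (real_coef d) ->
  series (qterm d x) @ \oo --> slice_fun (exp_stem (real_coef d)) x.
Proof.
move=> gd; have := slice_eval_cvg (x := x) (exp_series_cvg (w := cplx (slice_pt x)) gd).
by apply: cvg_trans; apply: near_eq_cvg; apply: nearW => n; rewrite /= series_qterm.
Qed.

(** The squared length of the imaginary part is at most 3 |x|^2, hence below (4 |x|)^2. *)
Lemma cplx_slice_pt_norm x : `|cplx (slice_pt x)| <= 4 * `|x|.
Proof.
have := lexx `|x|; rewrite {1}quat_norm_le => /and5P[_ x0 x1 x2 x3].
have b0 : 0 <= qimnorm x by exact: sqrtr_ge0.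
have sq (a : R) : `|a| <= `|x| -> a ^+ 2 <= `|x| ^+ 2.
  by move=> ax; rewrite -[a ^+ 2]real_normK ?num_real// lerXn2r ?nnegrE.
have n1 := quat_norm_one R.
have b4 : `|qimnorm x| <= 4 * `|x|.
  rewrite ger0_norm// -(@ler_pXn2r _ 2)// ?nnegrE ?mulr_ge0// qimnorm_sqr exprMn.
  have := sq _ x1; have := sq _ x2; have := sq _ x3; have := sqr_ge0 `|x|.
  by rewrite (_ : 4 ^+ 2 = 16 :> R); [lra | ring].
rewrite quatC_norm_le /cplx /= !normrZ; apply/andP; split.
  by have := ler_piMr (normr_ge0 (qre x)) n1; have := normr_ge0 x; lra.
by have := ler_piMr (normr_ge0 (qimnorm x)) n1; lra.
Qed.

(** A compact set is bounded, so its points are all evaluated from one ball of H (x) C, where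
    [exp_series_tail] is uniform. *)
Lemma qterm_cvg_uniform d (K : set (quat R)) : geom_bounded (real_coef d) ->
  compact K -> forall e : R, 0 < e -> \forall N \near \oo, forall x, K x ->
  `|slice_fun (exp_stem (real_coef d)) x - series (qterm d x) N| <= e.
Proof.
move=> gd /compact_bounded[M [_ MK]] e e0.
(* Here 32 = 8 * 4, with 8 from the hypothesis of [exp_series_tail] and 4 from [cplx_slice_pt_norm];
   |M| + 1 exceeds [M] whatever its sign. *)
pose B : R := 32 * (`|M| + 1).
have B0 : 0 <= B by rewrite mulr_ge0// addr_ge0.
(* The 5 compensates the constant of [slice_eval_norm]. *)
have e5 : 0 < e / 5 by rewrite divr_gt0.
apply: filterS (exp_series_tail B0 gd e5) => N tN x Kx.
have xM : `|x| <= `|M| + 1.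
  by apply: MK => //; have := ler_norm M; lra.
rewrite series_qterm slice_funP -slice_evalB; apply: le_trans (slice_eval_norm _ _) _.
rewrite mulrC -ler_pdivlMr//; apply: tN.
by have := cplx_slice_pt_norm x; rewrite /B; lra.
Qed.

End SliceSeries.

(** * Conjugation symmetry and holomorphy of exponential stems *)

Section Stems.
Variable R : realType.
Implicit Types (x lambda mu : quat R) (d : (quat R)^nat) (c : (quatC R)^nat).
Implicit Types (w t : quatC R) (z v : R * R) (D : set (R * R)) (F G : R * R -> quatC R).

Lemma quatC_norm_pair0 (q : quat R) : `|((q, 0) : quatC R)| = `|q|.
Proof. by rewrite prod_normE /= normr0; apply/max_idPl. Qed.

Lemma qCconj0 : qCconj (0 : quatC R) = 0.
Proof. by apply/eqP; rewrite xpair_eqE oppr0 !eqxx. Qed.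

Lemma qCconj1 : qCconj (1 : quatC R) = 1.
Proof. by apply/eqP; rewrite xpair_eqE oppr0 !eqxx. Qed.

Lemma qCconjM w t : qCconj (w * t) = qCconj w * qCconj t.
Proof.
rewrite [LHS]/qCconj !quatC_mulE /=.
by rewrite mulrNN mulrN mulNr opprD.
Qed.

Lemma qCconjD w t : qCconj (w + t) = qCconj w + qCconj t.
Proof. by rewrite /qCconj /= opprD. Qed.

Lemma qCconj_sum (u : nat -> quatC R) n :
  qCconj (\sum_(0 <= k < n) u k) = \sum_(0 <= k < n) qCconj (u k).
Proof. by apply: (big_morph (@qCconj R)); [exact: qCconjD | exact: qCconj0]. Qed.

Lemma qCconjB w t : qCconj (w - t) = qCconj w - qCconj t.
Proof. by rewrite /qCconj /= opprD. Qed.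

Lemma qCconjZ (a : R) w : qCconj (a *: w) = a *: qCconj w.
Proof. by rewrite /qCconj /= -scalerN. Qed.

Lemma qCconj_cvg (T : Type) (F : set_system T) {FF : Filter F} (f : T -> quatC R) w :
  f @ F --> w -> qCconj (f a) @[a --> F] --> qCconj w.
Proof.
move=> fw.
have c1 : (f a).1 @[a --> F] --> w.1 by apply: cvg_comp fw _; exact: cvg_fst.
have c2 : - (f a).2 @[a --> F] --> - w.2.
  by apply: cvgN; apply: cvg_comp fw _; exact: cvg_snd.
exact: (cvg_pair c1 c2).
Qed.

Lemma qCI_sqr : qCI R * qCI R = -1.
Proof.
rewrite quatC_mulE /= mul0r mulr0 mul1r mulr1 sub0r add0r.
by apply/eqP; rewrite xpair_eqE oppr0 !eqxx.
Qed.

Lemma qCI_comm w : qCI R * w = w * qCI R.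
Proof. by rewrite !quatC_mulE /= !mul0r !mulr0 !mul1r !mulr1 !add0r addr0. Qed.

(** Conjugation is multiplicative, real-linear and continuous; it fixes the coefficients and sends
    [cplx (a, b)] to [cplx (a, - b)], so it passes through partial sums and then through the
    limit. *)
Lemma stem_exp_stem D d : geom_bounded (real_coef d) ->
  stem D (exp_stem (real_coef d)).
Proof.
move=> gd a b _.
have h1 := exp_series_cvg (w := cplx (a, - b)) gd.
have h2 : qCconj (series (exp_term (real_coef d) (cplx (a, b))) N) @[N --> \oo] -->
    qCconj (exp_series (real_coef d) (cplx (a, b))).
  by apply: qCconj_cvg; exact: exp_series_cvg.
have e N : qCconj (series (exp_term (real_coef d) (cplx (a, b))) N) =
    series (exp_term (real_coef d) (cplx (a, - b))) N.
  apply: etrans (qCconj_sum _ _) _; apply: eq_bigr => n _.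
  rewrite /exp_term qCconjZ qCconjM.
  have -> : qCconj (real_coef d n) = real_coef d n by rewrite /qCconj /real_coef /= oppr0.
  have cb : qCconj (cplx (a, b)) = cplx (a, - b) by rewrite /cplx /qCconj /= scaleNr.
  suff -> : qCconj (cplx (a, b) ^+ n) = cplx (a, - b) ^+ n by [].
  elim: n => [|n IH]; first by rewrite !expr0 qCconj1.
  by rewrite !exprS qCconjM IH cb.
apply: (cvg_unique (@norm_hausdorff _ (quatC R)) h1).
by rewrite /= -(funext e).
Qed.

(** Turns an identity between coefficients into one between sums; the constant [t] can be factored
    out because coefficients stand to the right of the powers. *)
Lemma exp_seriesDM c c1 c2 w t : geom_bounded c1 -> geom_bounded c2 ->
  (forall n, c n = c1 n + c2 n * t) ->
  exp_series c w = exp_series c1 w + exp_series c2 w * t.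
Proof.
move=> g1 g2 cE; apply: (cvg_lim (@norm_hausdorff _ (quatC R))).
have h : series (exp_term c1 w) N + series (exp_term c2 w) N * t @[N --> \oo] -->
    exp_series c1 w + exp_series c2 w * t.
  apply: cvgD; first exact: exp_series_cvg.
  by apply: cvg_quatCM; [exact: exp_series_cvg | exact: cvg_cst].
apply: cvg_trans h; apply: near_eq_cvg; apply: nearW => N.
rewrite /series /= mulr_suml -big_split /=; apply: eq_bigr => n _.
by rewrite /exp_term cE mulrDr scalerDr -scalerAl mulrA.
Qed.

(** Each directional derivative is a constant times the stem of the shifted sequence, hence
    continuous. *)
Lemma class_C1_exp_stem D c : geom_bounded c -> class_C1 D (exp_stem c).
Proof.
move=> gc z _.
have gs := geom_bounded_shift gc.
have dE v : 'D_v (exp_stem c) = fun z => cplx v * exp_stem (fun n => c n.+1) z.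
  by apply/funext => y; have [_ ->] := is_derive_exp_stem y v gc.
have dC v : cplx v * exp_stem (fun n => c n.+1) y @[y --> z] -->
    cplx v * exp_stem (fun n => c n.+1) z.
  by apply: cvg_quatCM; [exact: cvg_cst | exact: exp_stem_continuous].
split.
- by have [] := is_derive_exp_stem z (1, 0) gc.
- by have [] := is_derive_exp_stem z (0, 1) gc.
- have E : d_alpha (exp_stem c) = _ := dE (1, 0); rewrite E; exact: dC.
- have E : d_beta (exp_stem c) = _ := dE (0, 1); rewrite E; exact: dC.
Qed.

Lemma cplx10 : cplx (1, 0) = 1 :> quatC R.
Proof. by rewrite /cplx /= scale1r scale0r. Qed.

Lemma cplx01 : cplx (0, 1) = qCI R.
Proof. by rewrite /cplx /= scale1r scale0r. Qed.

Lemma d_alpha_exp_stem c z : geom_bounded c ->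
  d_alpha (exp_stem c) z = exp_stem (fun n => c n.+1) z.
Proof.
move=> gc; rewrite /d_alpha.
by have [_ ->] := is_derive_exp_stem z (1, 0) gc; rewrite cplx10 mul1r.
Qed.

Lemma d_beta_exp_stem c z : geom_bounded c ->
  d_beta (exp_stem c) z = qCI R * exp_stem (fun n => c n.+1) z.
Proof.
move=> gc; rewrite /d_beta.
by have [_ ->] := is_derive_exp_stem z (0, 1) gc; rewrite cplx01.
Qed.

Lemma quatC_half_double (w : quatC R) : (2^-1 : R) *: (w + w) = w.
Proof. by rewrite -mulr2n -[X in _ *: X = _]scaler_nat scalerA mulVf ?scale1r// pnatr_eq0. Qed.

(** Since [d_beta] is I times [d_alpha] and I^2 = -1, the two halves add up here and cancel in
    [d_zbar]. *)
Lemma d_z_exp_stem c z : geom_bounded c ->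
  d_z (exp_stem c) z = exp_stem (fun n => c n.+1) z.
Proof.
move=> gc; rewrite /d_z d_alpha_exp_stem// d_beta_exp_stem// mulrA qCI_sqr mulN1r opprK.
exact: quatC_half_double.
Qed.

Lemma d_zbar_exp_stem c z : geom_bounded c -> d_zbar (exp_stem c) z = 0.
Proof.
move=> gc; rewrite /d_zbar d_alpha_exp_stem// d_beta_exp_stem// mulrA qCI_sqr mulN1r.
by rewrite subrr scaler0.
Qed.

End Stems.

(** * The coefficients of g and of the exponentials *)

Section Coefficients.
Variable R : realType.
Variables (lambda mu : quat R).

(** At n = 0 the sum is empty, which lets series indexed from 0 represent g. Outside the section
    [lambda] comes first, in contrast to [gfun]. *)
Definition gcoef n : quat R := \sum_(0 <= k < n) mu ^+ k * lambda ^+ (n - k - 1)%N.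

(** The summand k = n is mu^n, and every other one gains a factor [lambda] on the right. *)
Lemma gcoefS n : gcoef n.+1 = mu ^+ n + gcoef n * lambda.
Proof.
rewrite /gcoef big_nat_recr//= subSnn subnn expr0 mulr1 addrC; congr (_ + _).
rewrite mulr_suml big_nat_cond [RHS]big_nat_cond; apply: eq_bigr => k /andP[/andP[_ kn] _].
have -> : (n.+1 - k - 1 = (n - k - 1).+1)%N.
  by rewrite !subn1 subSn 1?ltnW//= prednK// subn_gt0.
by rewrite -mulrA -exprSr.
Qed.

Lemma quat_normX (q : quat R) n : `|q ^+ n| <= (4 * `|q|) ^+ n.
Proof.
elim: n => [|n IH]; first exact: quat_norm_one.
rewrite !exprS; apply: le_trans (quat_normM _ _) _.
by rewrite ler_pM ?mulr_ge0.
Qed.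

Lemma geom_bounded_powers (q : quat R) : geom_bounded (real_coef (fun n => q ^+ n)).
Proof.
exists 1 => //; exists (4 * `|q|); first exact: mulr_ge0.
by move=> n; rewrite quatC_norm_pair0 mul1r quat_normX.
Qed.

Lemma geom_bounded_gcoef : geom_bounded (real_coef gcoef).
Proof.
(* The summand 4 |mu| gives |mu^n| <= r^n; then [gcoefS] needs 1 + 4 |lambda| <= r. *)
pose r : R := 4 * `|mu| + 4 * `|lambda| + 1.
have m0 := normr_ge0 mu; have l0 := normr_ge0 lambda.
have r0 : 0 <= r by rewrite /r; lra.
exists 1 => //; exists r => // n; rewrite quatC_norm_pair0 mul1r.
elim: n => [|n IH]; first by rewrite /gcoef big_geq// normr0 expr0.
rewrite gcoefS; apply: le_trans (ler_normD _ _) _.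
have h1 : `|mu ^+ n| <= r ^+ n.
  apply: le_trans (quat_normX _ _) _; apply: lerXn2r; rewrite ?nnegrE ?mulr_ge0//.
  by rewrite /r; lra.
have h2 : `|gcoef n * lambda| <= 4 * `|lambda| * r ^+ n.
  apply: le_trans (quat_normM _ _) _.
  by rewrite -!mulrA ler_wpM2l// mulrC ler_wpM2l.
have rn : 0 <= r ^+ n by rewrite exprn_ge0.
have h3 : 0 <= 4 * `|mu| * r ^+ n by rewrite !mulr_ge0.
rewrite exprS {1}/r; lra.
Qed.

(** [series] at N + 1 runs over the indices 0 to N, and its term at 0 vanishes. *)
Lemma gpartialE N x : gpartial mu lambda N x = series (qterm gcoef x) N.+1.
Proof.
rewrite /series /= /gpartial [RHS]big_nat_recl// [X in X + _](_ : _ = 0).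
  rewrite add0r big_add1 /=; apply: eq_bigr => n _.
  by rewrite /qterm scalerAl.
by rewrite /qterm /gcoef big_geq// mulr0 scaler0.
Qed.

Lemma gfunE x : gfun mu lambda x = slice_fun (exp_stem (real_coef gcoef)) x.
Proof.
apply: (cvg_lim (@norm_hausdorff _ (quat R))).
rewrite (_ : (fun N => gpartial mu lambda N x) = [sequence series (qterm gcoef x) N.+1]_N).
  by rewrite cvg_shiftS; apply: qterm_cvg; exact: geom_bounded_gcoef.
by apply/funext => N; exact: gpartialE.
Qed.

Lemma gfun_stem_derive z :
  exp_stem (fun n => real_coef gcoef n.+1) z =
  exp_stem (real_coef (fun n => mu ^+ n)) z
    + exp_stem (real_coef gcoef) z * (lambda, 0).
Proof.
apply: exp_seriesDM => [||n]; [exact: geom_bounded_powers|exact: geom_bounded_gcoef|].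
by rewrite /real_coef gcoefS quatC_mulE /= !mulr0 !mul0r subr0 addr0; congr pair; rewrite addr0.
Qed.

End Coefficients.

Lemma qexpE (R : realType) (lambda x : quat R) :
  qexp lambda x = slice_fun (exp_stem (real_coef (fun n => lambda ^+ n))) x.
Proof.
apply: (cvg_lim (@norm_hausdorff _ (quat R))).
exact/qterm_cvg/geom_bounded_powers.
Qed.

(** * Slice derivatives computed on stems, and stems of slice-constant functions *)

Section SliceDerivatives.
Variable R : realType.
Implicit Types (x lambda mu : quat R) (f g h : quat R -> quat R).
Implicit Types (w t : quatC R) (z v : R * R) (D : set (R * R)) (F G : R * R -> quatC R).

(** [slice_pt] selects the representative with nonnegative second coordinate; conjugation invariance
    covers b < 0. *)
Lemma slice_pt_circularization D x :
  conj_invariant D -> circularization D x -> D (slice_pt x).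
Proof.
move=> cD [a [b [J [Dab /imag_unitE[J0 J1] ->]]]].
have -> : slice_pt (a%:A + b *: J) = (a, `|b|).
  congr (_, _); first by rewrite !qE J0; ring.
  by rewrite /qimnorm !qE -sqrtr_sqr; congr Num.sqrt; rewrite -[RHS]mulr1 -J1; ring.
by have [b0|b0] := leP 0 b; [rewrite ger0_norm | rewrite ltr0_norm//; exact: cD].
Qed.

Lemma stem_of_eq D F f z : conj_invariant D -> induces D F f -> D z ->
  stem_of D f z = F z.
Proof. by move=> cD iF; apply: induces_uniq (induces_stem_of iF) iF _. Qed.

Lemma d_z_eq D F G z : open D -> (forall y, D y -> F y = G y) -> D z ->
  d_z F z = d_z G z.
Proof.
move=> oD FG Dz; have nD : \forall y \near z, F y = G y.
  by apply: filterS (open_nbhs_nbhs (conj oD Dz)).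
by rewrite /d_z /d_alpha /d_beta !(near_eq_derive _ nD).
Qed.

(** [stem_of] is determined by [f] only on [D], but [D] is open, so its derivatives there are
    determined too. *)
Lemma slice_derivativeE D F f x : open D -> conj_invariant D -> induces D F f ->
  circularization D x -> slice_derivative D f x = slice_fun (d_z F) x.
Proof.
move=> oD cD iF Dx; have Dp := slice_pt_circularization cD Dx.
have e : d_z (stem_of D f) (slice_pt x) = d_z F (slice_pt x).
  by apply: (d_z_eq oD _ Dp) => y Dy; exact: stem_of_eq.
by rewrite [LHS]slice_funP e.
Qed.

Lemma is_deriveNdir F z v w : is_derive z v F w -> is_derive z (- v) F (- w).
Proof.
move=> /is_deriveP Fw; apply/is_deriveP.
have N0 : - h @[h --> (0 : R)^'] --> (0 : R)^'.
  rewrite -[X in _ --> X^'](oppr0 R); apply: continuous_injective_withinNx.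
    exact: opp_continuous.
  by move=> y /eqP; rewrite eqr_opp => /eqP.
have c : (- h)^-1 *: (F (- h *: v + z) - F z) @[h --> (0 : R)^'] --> w.
  pose g (h : R) := h^-1 *: (F (h *: v + z) - F z).
  have gw : g @ (0 : R)^' --> w by [].
  exact: (cvg_trans (cvg_app g N0) gw).
have Nc : - ((- h)^-1 *: (F (- h *: v + z) - F z)) @[h --> (0 : R)^'] --> - w.
  exact: cvgN.
apply: cvg_trans Nc; apply: near_eq_cvg.
apply: nearW => h /=; rewrite invrN scaleNr opprK; congr (_ *: (F (_ + _) - _)).
by rewrite scalerN scaleNr.
Qed.

Lemma dir_cvg z v : h *: v + z @[h --> (0 : R)^'] --> z.
Proof.
have : h *: v + z @[h --> (0 : R)^'] --> 0 *: v + z.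
  by apply: cvgD; [apply: cvgZl; exact: cvg_within | exact: cvg_cst].
by rewrite scale0r add0r.
Qed.

Lemma near_dir D z v : open D -> D z -> \forall h \near (0 : R)^', D (h *: v + z).
Proof.
move=> oD Dz; have nD : nbhs z D by exact: open_nbhs_nbhs.
exact: (@dir_cvg z v D nD).
Qed.

(** Near (a, b) the stem identity turns conjugated difference quotients into difference quotients at
    the reflected point in the reflected direction. *)
Lemma is_derive_stem_conj D F a b v w : open D -> stem D F -> D (a, b) ->
  is_derive (a, b) v F w -> is_derive (a, - b) (v.1, - v.2) F (qCconj w).
Proof.
move=> oD sF Dab /is_deriveP Fw; apply/is_deriveP.
have Cw : qCconj (h^-1 *: (F (h *: v + (a, b)) - F (a, b))) @[h --> (0 : R)^'] -->
    qCconj w by exact: qCconj_cvg.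
apply: cvg_trans Cw; apply: near_eq_cvg.
apply: filterS (near_dir v oD Dab) => h Dh.
rewrite qCconjZ qCconjB -sF// [h *: v + _]surjective_pairing -sF -?surjective_pairing//.
by rewrite /= opprD -scalerN.
Qed.

(** Reflection keeps the first direction and reverses the second, while conjugation reverses I; the
    two signs cancel. *)
Lemma stem_d_z D F : open D -> stem D F -> class_C1 D F -> stem D (d_z F).
Proof.
move=> oD sF CF a b Dab; have [da db _ _] := CF _ Dab.
have [_ ha] := is_derive_stem_conj oD sF Dab (derivableP da).
have := is_deriveNdir (is_derive_stem_conj oD sF Dab (derivableP db)).
rewrite /= (_ : - (0, -1) = (0, 1) :> R * R); last first.
  by apply/eqP; rewrite xpair_eqE oppr0 opprK !eqxx.
move=> [_ hb]; move: ha; rewrite /= oppr0 => ha.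
rewrite /d_z /d_alpha /d_beta ha hb qCconjZ qCconjB qCconjM; congr (_ *: _).
have -> : qCconj (qCI R) = - qCI R by apply/eqP; rewrite xpair_eqE oppr0 !eqxx.
by rewrite mulrN mulNr.
Qed.

(** Leibniz rule with one term gone: the increment is (F(y) - F(z)) G(y) + F(z) (G(y) - G(z)), and
    continuity of [G] controls the first summand. *)
Lemma is_derive_mul0 F G z v w : is_derive z v F 0 -> is_derive z v G w ->
  {for z, continuous G} -> is_derive z v (fun y => F y * G y) (F z * w).
Proof.
move=> /is_deriveP F0 /is_deriveP Gw cG; apply/is_deriveP.
have c : h *: v + z @[h --> (0 : R)^'] --> z by exact: dir_cvg.
have Gz : G (h *: v + z) @[h --> (0 : R)^'] --> G z by apply: cvg_comp c cG.
have P : h^-1 *: (F (h *: v + z) - F z) * G (h *: v + z)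
    + F z * (h^-1 *: (G (h *: v + z) - G z)) @[h --> (0 : R)^'] --> F z * w.
  rewrite -[F z * w]add0r -[X in X + _](mul0r (G z)).
  by apply: cvgD; apply: cvg_quatCM => //; exact: cvg_cst.
apply: cvg_trans P; apply: near_eq_cvg; apply: nearW => h /=.
by rewrite -scalerAl -scalerAr -scalerDr mulrBl mulrBr addrA subrK.
Qed.

(** [d_z F] and 0 are two stems of the slice derivative, so they agree on [D] by uniqueness. With
    [d_zbar F] = 0 this kills both partial derivatives. *)
Lemma slice_constant_stem D h : axially_symmetric_domain D -> slice_constant D h ->
  induces D (stem_of D h) h /\
  forall z, D z -> is_derive z (1, 0) (stem_of D h) 0 /\ is_derive z (0, 1) (stem_of D h) 0.
Proof.
move=> [oD cD _ _] [[F [iF CF dF]] hc].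
split=> [|z Dz]; first exact: induces_stem_of iF.
have i1 : induces D (d_z F) (slice_derivative D h).
  split; first by apply: stem_d_z => //; case: iF.
  by move=> x Dx; exact: slice_derivativeE.
have i0 : induces D (fun=> 0) (slice_derivative D h).
  split; first by move=> a b _; rewrite qCconj0.
  by move=> x Dx; rewrite hc// slice_funP /slice_eval mulr0 addr0.
have dz0 : d_z F z = 0 by apply: (induces_uniq cD i1 i0).
have [da db _ _] := CF _ Dz.
have a0 : d_alpha F z = 0.
  have : d_zbar F z + d_z F z = 0 by rewrite dz0 dF// addr0.
  by rewrite /d_zbar /d_z -scalerDr addrACA subrr addr0 quatC_half_double.
have b0 : d_beta F z = 0.
  have := dF z Dz; rewrite /d_zbar a0 add0r => /eqP.
  rewrite scaler_eq0 invr_eq0 pnatr_eq0 /= => /eqP Ib0.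
  have : qCI R * (qCI R * d_beta F z) = 0 by rewrite Ib0 mulr0.
  by rewrite mulrA qCI_sqr mulN1r => /eqP; rewrite oppr_eq0 => /eqP.
(* The conclusion concerns the chosen stem, which agrees with [F] near z. *)
have nD : \forall y \near z, F y = stem_of D h y.
  apply: filterS (open_nbhs_nbhs (conj oD Dz)) => y Dy.
  by rewrite (stem_of_eq cD iF Dy).
split; apply: (near_eq_is_derive nD).
- exact: (DeriveDef da a0).
- exact: (DeriveDef db b0).
Qed.

End SliceDerivatives.

(** * The properties of g *)

Section Proposition.
Variable R : realType.
Implicit Types (lambda mu x : quat R) (D : set (R * R)).

Lemma induces_gfun D lambda mu :
  induces D (exp_stem (real_coef (gcoef lambda mu))) (gfun mu lambda).
Proof.
split=> [|x _]; last exact: gfunE.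
exact/stem_exp_stem/geom_bounded_gcoef.
Qed.

Lemma induces_qexp D lambda :
  induces D (exp_stem (real_coef (fun n => lambda ^+ n))) (qexp lambda).
Proof.
split=> [|x _]; last exact: qexpE.
exact/stem_exp_stem/geom_bounded_powers.
Qed.

Lemma d_z_gfun_stem lambda mu z :
  d_z (exp_stem (real_coef (gcoef lambda mu))) z =
  exp_stem (real_coef (fun n => mu ^+ n)) z
    + exp_stem (real_coef (gcoef lambda mu)) z * (lambda, 0).
Proof.
by rewrite d_z_exp_stem ?gfun_stem_derive//; exact: geom_bounded_gcoef.
Qed.

Lemma gpartial_uniform_cvg lambda mu (K : set (quat R)) : compact K ->
  {uniform K, gpartial mu lambda @ \oo --> gfun mu lambda}.
Proof.
move=> cK P; rewrite uniform_nbhs => -[E [entE subE]].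
suff : \forall N \near \oo, forall y, K y -> E (gfun mu lambda y, gpartial mu lambda N y).
  by apply: filterS => N EN; exact: subE.
move: entE; rewrite -entourage_ballE => -[e /= e0 eE].
(* The tail bound is a weak inequality and the ball is open, hence the half. *)
have e2 : 0 < e / 2 by rewrite divr_gt0.
have [N0 _ NP] := qterm_cvg_uniform (geom_bounded_gcoef lambda mu) cK e2.
exists N0 => // N /= N0N y Ky; apply: eE => /=.
rewrite -ball_normE /= gpartialE gfunE.
apply: le_lt_trans (NP N.+1 (leqW N0N) y Ky) _.
by rewrite ltr_pdivrMr// mulr_natr mulr2n ltrDl.
Qed.

Lemma entire_gfun lambda mu : entire (gfun mu lambda).
Proof.
have gg := geom_bounded_gcoef lambda mu.
exists (exp_stem (real_coef (gcoef lambda mu))); split.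
- exact: induces_gfun.
- exact: class_C1_exp_stem.
- by move=> z _; exact: d_zbar_exp_stem.
Qed.

Lemma slice_diff_gfun lambda mu x : slice_diff setT lambda (gfun mu lambda) x = qexp mu x.
Proof.
have Tx : circularization setT x by rewrite circularizationT.
rewrite /slice_diff (slice_derivativeE _ _ (induces_gfun _ _ _) Tx)//; last exact: openT.
by rewrite slice_funP d_z_gfun_stem slice_evalD slice_evalMr gfunE qexpE addrK.
Qed.

Lemma gfun0 lambda mu : gfun mu lambda 0 = 0.
Proof.
rewrite /gfun (_ : (fun N => gpartial mu lambda N 0) = fun=> 0).
  exact: (lim_cst (@norm_hausdorff _ (quat R))).
apply/funext => N; rewrite /gpartial big_nat big1// => n /andP[n0 _].
by rewrite expr0n -[n == 0%N]negbK -lt0n n0 scaler0 mul0r.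
Qed.

(** On stems the derivative of H G is H G' = H (E + G lambda), because the partial derivatives of H
    vanish. Right multiplication by [lambda] passes through [slice_eval], so subtracting it leaves H
    E. *)
Lemma slice_diff_prod_gfun lambda mu D h x :
  axially_symmetric_domain D -> slice_constant D h -> circularization D x ->
  slice_diff D lambda (slice_prod D h (gfun mu lambda)) x = slice_prod D h (qexp mu) x.
Proof.
move=> aD ch Dx; have [[sH hH] dH] := slice_constant_stem aD ch.
have [oD cD _ _] := aD; have Dp := slice_pt_circularization cD Dx.
have gg := geom_bounded_gcoef lambda mu.
set H := stem_of D h in sH hH dH.
pose G := exp_stem (real_coef (gcoef lambda mu)).
pose E := exp_stem (real_coef (fun n => mu ^+ n)).
have prodE y : circularization D y ->
    slice_prod D h (gfun mu lambda) y = slice_fun (fun z => H z * G z) y.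
  move=> Dy; rewrite /slice_prod !slice_funP.
  by rewrite (stem_of_eq cD (induces_gfun D lambda mu))//; exact: slice_pt_circularization.
have iP : induces D (fun z => H z * G z) (slice_prod D h (gfun mu lambda)).
  have sG : stem D G by exact: stem_exp_stem.
  split; last exact: prodE.
  by move=> a b Dab; rewrite (sH _ _ Dab) (sG _ _ Dab) qCconjM.
have cG : {for slice_pt x, continuous G} by exact: exp_stem_continuous.
have [Ha Hb] := dH _ Dp.
have [_ da] := is_derive_mul0 Ha (is_derive_exp_stem _ _ gg) cG.
have [_ db] := is_derive_mul0 Hb (is_derive_exp_stem _ _ gg) cG.
have dzP : d_z (fun z => H z * G z) (slice_pt x) =
    H (slice_pt x) * E (slice_pt x) + H (slice_pt x) * G (slice_pt x) * (lambda, 0).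
  rewrite -mulrA -mulrDr -gfun_stem_derive /d_z /d_alpha /d_beta da db.
  (* I is central, so its two occurrences meet across H and give -1. *)
  rewrite cplx10 cplx01 mul1r !mulrA qCI_comm -[_ * qCI R * qCI R]mulrA qCI_sqr.
  by rewrite mulrN1 mulNr opprK quatC_half_double.
rewrite /slice_diff (slice_derivativeE oD cD iP Dx) prodE// !slice_funP dzP.
rewrite slice_evalD slice_evalMr addrK /slice_prod slice_funP.
by rewrite (stem_of_eq cD (induces_qexp D mu)).
Qed.

(** The factorization of mu^n - lambda^n through its geometric sum; commutation moves [lambda] past
    mu - lambda in the induction. *)
Lemma gcoef_comm lambda mu n : lambda * mu = mu * lambda ->
  mu ^+ n = lambda ^+ n + gcoef lambda mu n * (mu - lambda).
Proof.
move=> lm; elim: n => [|n IH].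
  by rewrite !expr0 /gcoef big_geq// mul0r addr0.
rewrite gcoefS mulrDl -mulrA.
have -> : lambda * (mu - lambda) = (mu - lambda) * lambda.
  by rewrite mulrBr mulrBl lm.
rewrite mulrA -[gcoef _ _ _ * _](addKr (lambda ^+ n)) -IH mulrDl mulNr -!exprSr mulrBr.
rewrite -exprSr; move: (mu ^+ n * lambda) (lambda ^+ n.+1) (mu ^+ n.+1) => X L M.
by rewrite [- L + X]addrC [_ + (X - L)]addrA subrK [RHS]addrC subrK.
Qed.

(** [exp_seriesDM] sums the identity [gcoef_comm], and mu - lambda, a nonzero quaternion, is then
    divided out on the right. *)
Lemma gfun_comm lambda mu x : lambda * mu = mu * lambda -> lambda <> mu ->
  gfun mu lambda x = (qexp mu x - qexp lambda x) * (mu - lambda)^-1.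
Proof.
move=> lm nlm; set q := mu - lambda.
have q0 : q != 0 by rewrite subr_eq0 eq_sym; apply/eqP.
have uq : q \is a GRing.unit.
  by apply/unitrP; exists (qinv q); split; [exact: qmulVx | exact: qmulxV].
suff -> : qexp mu x - qexp lambda x = gfun mu lambda x * q by rewrite mulrK.
have cE n : real_coef (fun n => mu ^+ n) n = real_coef (fun n => lambda ^+ n) n
    + real_coef (gcoef lambda mu) n * (q, 0).
  rewrite /real_coef (gcoef_comm _ lm) quatC_mulE /= !mulr0 mul0r subr0 addr0.
  by apply/eqP; rewrite xpair_eqE /= addr0 !eqxx.
have e : exp_stem (real_coef (fun n => mu ^+ n)) (slice_pt x) =
    exp_stem (real_coef (fun n => lambda ^+ n)) (slice_pt x)
      + exp_stem (real_coef (gcoef lambda mu)) (slice_pt x) * (q, 0).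
  exact: exp_seriesDM (geom_bounded_powers _) (geom_bounded_gcoef _ _) cE.
rewrite (qexpE mu) (qexpE lambda) gfunE [slice_fun _ x in X in X - _]slice_funP e.
by rewrite slice_evalD slice_evalMr addrAC subrr add0r.
Qed.

Lemma gcoef_diag lambda n : gcoef lambda lambda n.+1 = lambda ^+ n *+ n.+1.
Proof.
elim: n => [|n IH]; rewrite gcoefS; first by rewrite /gcoef big_geq// mul0r addr0.
by rewrite IH mulrnAl -exprSr -mulrS.
Qed.

(** Since (n + 1) / (n + 1)! = 1 / n!, term n + 1 of the series of g is [w] times term n of the
    exponential series. *)
Lemma gfun_diag lambda x : gfun lambda lambda x = x * qexp lambda x.
Proof.
have gp := geom_bounded_powers lambda; have gg := geom_bounded_gcoef lambda lambda.
set p := real_coef (fun n => lambda ^+ n) in gp.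
rewrite gfunE qexpE !slice_funP -slice_eval_cplxM; set w := cplx (slice_pt x).
suff -> : exp_stem (real_coef (gcoef lambda lambda)) (slice_pt x) = w * exp_series p w by [].
apply: (cvg_lim (@norm_hausdorff _ (quatC R))).
(* The term at 0 vanishes, so N + 1 terms on this side match N terms of the exponential. *)
rewrite -(cvg_shiftS (series (exp_term (real_coef (gcoef lambda lambda)) w))).
have c : w * series (exp_term p w) N @[N --> \oo] --> w * exp_series p w.
  by apply: cvg_quatCM; [exact: cvg_cst | exact: exp_series_cvg].
apply: cvg_trans c; apply: near_eq_cvg; apply: nearW => N.
rewrite /series /= mulr_sumr big_nat_recl// [X in _ = X + _](_ : _ = 0); last first.
  by rewrite /exp_term /real_coef /gcoef big_geq// mulr0 scaler0.
rewrite add0r; apply: eq_bigr => n _; rewrite /exp_term.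
have -> : real_coef (gcoef lambda lambda) n.+1 = (n.+1%:R : R) *: p n.
  by rewrite /p /real_coef gcoef_diag -scaler_nat; apply/eqP; rewrite xpair_eqE /= scaler0 !eqxx.
by rewrite -!scalerAr scalerA exprS mulrA factS natrM invfM mulrAC mulVf ?mul1r//.
Qed.

End Proposition.

Unset Implicit Arguments.
Set Strict Implicit.

Theorem proposition8 (R : realType) (lambda mu : quat R) :
  [/\ (* the series converges uniformly on compact sets, with sum g *)
      (forall K : set (quat R), compact K ->
         {uniform K, gpartial mu lambda @ \oo --> gfun mu lambda}),
      [/\ entire (gfun mu lambda),
          (forall x, slice_diff setT lambda (gfun mu lambda) x = qexp mu x)
        & gfun mu lambda 0 = 0],
      (forall (D : set (R * R)) (h : quat R -> quat R),
         axially_symmetric_domain D -> slice_constant D h ->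
         forall x, circularization D x ->
           slice_diff D lambda (slice_prod D h (gfun mu lambda)) x =
           slice_prod D h (qexp mu) x),
      (lambda * mu = mu * lambda -> lambda <> mu ->
         forall x, gfun mu lambda x =
           (qexp mu x - qexp lambda x) * (mu - lambda)^-1)
    & (lambda = mu -> forall x, gfun lambda lambda x = x * qexp lambda x)].
Proof.
split.
- by move=> K; exact: gpartial_uniform_cvg.
- split; [exact: entire_gfun | exact: slice_diff_gfun | exact: gfun0].
- by move=> D h aD ch x; exact: slice_diff_prod_gfun.
- by move=> lm nlm x; exact: gfun_comm.
- by move=> _ x; exact: gfun_diag.
Qed.
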